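(* Let $q\in\mathbb N_1$ and let $P_\bullet=(P_n)_{n\ge0}$ be a $q$-chromatic partition structure satisfying: (a) $P_n[A]>0$ for every $n\in\mathbb N_1$ and every $A\in\mathcal A^{(q)}_n$; (b) for every $n\in\mathbb N_1$, every $A\in\mathcal A^{(q)}_n$, and every $\mathbf r\in\mathbb N^q_*$ with $\mathbf 1_{\mathbf r}\le A$, $$|\mathbf r|\,A(\mathbf r)\,P_n[A]=b(n,\mathbf r)\,P_{n-|\mathbf r|}[A-\mathbf 1_{\mathbf r}]$$ for some constant $b(n,\mathbf r)$ independent of $A$. Then $P_n=\mathscr E^n_{\theta,\nu}$ for every $n$, for a unique $\theta>0$ and a unique Borel probability measure $\nu$ on $\Delta^{q-1}$.
   Context: Notation: $\mathbb N_1=\{1,2,\dots\}$, $\mathbb N_0=\{0,1,\dots\}$, $[q]=\{1,\dots,q\}$, $\mathbb N^q_*=\mathbb N_0^q\setminus\{\mathbf 0\}$, $0^0=1$; $|\mathbf a|=\sum_ja_j$, $\mathbf u^{\mathbf a}=\prod_ju_j^{a_j}$, $\binom{|\mathbf a|}{\mathbf a}=|\mathbf a|!/\prod_ja_j!$; $\mathbf e_j$ canonical basis vectors; $\Delta^{q-1}=\{\mathbf u\in[0,1]^q:|\mathbf u|=1\}$; $\langle\theta\rangle_n=\theta(\theta+1)\cdots(\theta+n-1)$. A $q$-chromatic partition of $n\in\mathbb N_0$ is a finitely supported map $A\colon\mathbb N^q_*\to\mathbb N_0$ with $\sum_{\mathbf a}A(\mathbf a)|\mathbf a|=n$; $\mathcal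 A^{(q)}_n$ is the set of these ($\mathcal A^{(q)}_0=\{0\}$); $\mathbf 1_{\mathbf a}$ is the multiset with single element $\mathbf a$; operations and $\le$ are pointwise; $\mathrm{supp}A$ is the support. For $\mathbf a\in\mathrm{supp}A$, $j\in[q]$ with $a_j\ge1$: $A_{\setminus\mathbf a,j}=A-\mathbf 1_{\mathbf a}$ if $\mathbf a=\mathbf e_j$, else $A-\mathbf 1_{\mathbf a}+\mathbf 1_{\mathbf a-\mathbf e_j}$. $S_{n-1,n}(A,B)=a_jA(\mathbf a)/n$ if $B=A_{\setminus\mathbf a,j}$, and $0$ otherwise. A $q$-chromatic partition structure is a sequence $(P_n)_{n\ge0}$ of probability measures $P_n$ on $\mathcal A^{(q)}_n$ with $P_{n-1}[B]=\sum_{A\in\mathcal A^{(q)}_n}P_n[A]\,S_{n-1,n}(A,B)$ for all $n\ge1$, $B\in\mathcal A^{(q)}_{n-1}$. Polychromatic Ewens Sampling Formula (pESF): with $m_{\mathbf a}(\nu)=\int_{\Delta^{q-1}}\mathbf u^{\mathbf a}\,d\nu(\mathbf u)$, $$\mathscr E^n_{\theta,\nu}[A]=\frac{n!}{\langle\theta\rangle_n}\prod_{\mathbf a\in\mathrm{supp}A}\frac1{A(\mathbf a)!}\Big(\frac{\theta}{|\mathbf a|}\binom{|\mathbf a|}{\mathbf a}m_{\mathbf a}(\nu)\Big)^{A(\mathbf a)},\qquad A\in\mathcal A^{(q)}_n.$$ *)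

(* Defs.v *)
From HB Require Import structures.
From mathcomp Require Import all_boot all_order all_algebra.
From mathcomp Require Import finmap multiset.
From mathcomp Require Import all_classical all_reals all_analysis.

Set Implicit Arguments.
Unset Strict Implicit.
Unset Printing Implicit Defensive.
Import Order.TTheory GRing.Theory Num.Theory.
Import numFieldNormedType.Exports.

Local Open Scope classical_set_scope.
Local Open Scope ring_scope.
Local Open Scope mset_scope.

(** Nonzero elements of [N^q]; [N^q] is [{ffun 'I_q -> nat}], with its pointwise
    zero. *)
Record cvec (q : nat) := Cvec {
  cvec_val :> {ffun 'I_q -> nat};
  _ : cvec_val != 0 }.

HB.instance Definition _ q := [isSub for @cvec_val q].
HB.instance Definition _ q := [Choice of cvec q by <:].

Definition csize q (a : {ffun 'I_q -> nat}) : nat := (\sum_(j < q) a j)%N.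

Definition cbasis q (j : 'I_q) : {ffun 'I_q -> nat} := [ffun i => (i == j : nat)].

(** The finitely supported maps [N^q_* -> N_0] are the finite multisets
    [{mset cvec q}]. *)
Definition cweight q (A : {mset cvec q}) : nat :=
  (\sum_(a <- finsupp A) A a * csize a)%N.

Definition cpart q (n : nat) : set {mset cvec q} := [set A | cweight A = n].
Arguments cpart q n : clear implicits.

(** [A_{\a,j}]: one unit of colour [j] is taken from a block [a] of [A].
    Meant for [a] in the support of [A] and [1 <= a j]; then [a - e_j] is nonzero
    as soon as [a <> e_j], so that the default value of [insubd] is not used. *)
Definition cremove q (A : {mset cvec q}) (a : cvec q) (j : 'I_q) : {mset cvec q} :=
  if (a : {ffun _ -> _}) == cbasis j then A `\ a
  else (A `\ a) `+` [mset insubd a [ffun i => (a i - cbasis j i)%N]].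

(** [S_{n-1,n}(A, B)]: the pair [(a, j)] with [B = A_{\a,j}] is unique if it
    exists, so this sum has at most one term: see [ctrans_cremove], [ctrans_eq0]. *)
Definition ctrans (R : realType) q (n : nat) (A B : {mset cvec q}) : R :=
  \sum_(a <- finsupp A) \sum_(j < q | (0 < a j)%N && (B == cremove A a j))
    (a j * A a)%:R / n%:R.

Lemma cremove_val q (a : cvec q) (j : 'I_q) : (0 < a j)%N ->
  cvec_val a != cbasis j ->
  cvec_val (insubd a [ffun i => (a i - cbasis j i)%N])
  = [ffun i => (a i - cbasis j i)%N].
Proof.
move=> aj0 aj; rewrite -[cvec_val _]/(val _) val_insubd; case: ifPn => //.
rewrite negbK => /eqP/ffunP a0; case/eqP: aj; apply/ffunP => i.
have := a0 i; rewrite !ffunE; have [->|ij] := eqVneq i j.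
  by move=> /eqP; rewrite subn_eq0 => aj1; apply/eqP; rewrite eqn_leq aj1.
by rewrite subn0.
Qed.

Lemma cremoveE q (A : {mset cvec q}) (a : cvec q) (j : 'I_q) b :
  cremove A a j b =
  (A b - (b == a) + (if cvec_val a == cbasis j then 0 else
    b == insubd a [ffun i => (a i - cbasis j i)%N]))%N.
Proof.
rewrite /cremove; case: ifP => _; first by rewrite addn0 msetB1E.
by rewrite msetE2 msetB1E msetnE; case: (b == insubd _ _).
Qed.

Lemma cremove_inj q (A : {mset cvec q}) (a a' : cvec q) (j j' : 'I_q) :
  a \in A -> a' \in A -> (0 < a j)%N -> (0 < a' j')%N ->
  cremove A a j = cremove A a' j' -> a = a' /\ j = j'.
Proof.
rewrite !in_mset => aA a'A aj a'j' /msetP E.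
have aa' : a = a'.
  apply/eqP/negP => /negP naa'.
  have := E a; rewrite !cremoveE eqxx (negbTE naa') subn0.
  suff -> : (if cvec_val a == cbasis j then 0%N else
    a == insubd a [ffun i => (a i - cbasis j i)%N] : nat) = 0%N.
    rewrite addn0 => Ea; have := leq_addr
     (if cvec_val a' == cbasis j' then 0%N else
    a == insubd a' [ffun i => (a' i - cbasis j' i)%N] : nat) (A a).
    by rewrite -Ea leqNgt ltn_subrL aA.
  case: ifPn => // nb; case: eqP => // ea; exfalso.
  have := cremove_val aj nb; rewrite -ea => /ffunP /(_ j).
  rewrite !ffunE eqxx => /eqP.
  by rewrite gtn_eqF// ltn_subrL aj.
subst a'; split=> //.
have key b : (if cvec_val a == cbasis j then 0%N else
    b == insubd a [ffun i => (a i - cbasis j i)%N] : nat) =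
   (if cvec_val a == cbasis j' then 0%N else
    b == insubd a [ffun i => (a i - cbasis j' i)%N] : nat).
  by have /eqP := E b; rewrite !cremoveE eqn_add2l => /eqP.
move: key; case: (boolP (cvec_val a == cbasis j)) => [/eqP ej|ej];
  case: (boolP (cvec_val a == cbasis j')) => [/eqP ej'|ej'] key.
- move: a'j'; rewrite ej ffunE; by case: eqP.
- by have := key (insubd a [ffun i => (a i - cbasis j' i)%N]); rewrite eqxx.
- by have := key (insubd a [ffun i => (a i - cbasis j i)%N]); rewrite eqxx.
have := key (insubd a [ffun i => (a i - cbasis j i)%N]); rewrite eqxx.
case: eqP => // /(congr1 (@cvec_val q)); rewrite !cremove_val// => /ffunP/(_ j).
rewrite !ffunE eqxx; case: eqP => // _ /eqP.
by rewrite subn0 subn1 => /eqP; move: aj; case: (cvec_val a j) => // n _ /= /n_Sn.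
Qed.

Lemma ctrans_cremove (R : realType) q n (A : {mset cvec q}) (a : cvec q) (j : 'I_q) :
  a \in A -> (0 < a j)%N ->
  ctrans R n A (cremove A a j) = (a j * A a)%:R / n%:R.
Proof.
move=> aA aj; rewrite /ctrans (big_rem a) ?msuppE//=.
rewrite (bigD1 j) ?aj ?eqxx//= big1 ?addr0; last first.
  move=> i /andP[/andP[ai /eqP /(cremove_inj aA aA aj ai)[_ ->]]].
  by rewrite eqxx.
rewrite big_seq big1 ?addr0// => b; rewrite mem_rem_uniq ?fset_uniq// inE.
move=> /andP[/eqP ba]; rewrite msuppE => bA; rewrite big1// => i /andP[bi /eqP].
by move=> /(cremove_inj aA bA aj bi)[/esym].
Qed.

Lemma ctrans_eq0 (R : realType) q n (A B : {mset cvec q}) :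
  (forall (a : cvec q) (j : 'I_q), a \in A -> (0 < a j)%N -> B <> cremove A a j) ->
  ctrans R n A B = 0.
Proof.
move=> AB; rewrite /ctrans big_seq big1// => a; rewrite msuppE => aA.
by rewrite big1// => j /andP[aj /eqP /(AB _ _ aA aj)].
Qed.

Lemma cweight_ge q (A : {mset cvec q}) a : (A a * csize a <= cweight A)%N.
Proof.
have [aA|] := boolP (a \in finsupp A); last by rewrite memNfinsupp => /eqP ->.
by rewrite /cweight (big_rem a)//= leq_addr.
Qed.

Lemma cvec_csize_gt0 q (a : cvec q) : (0 < csize a)%N.
Proof.
rewrite lt0n; apply: contra (valP a); rewrite sum_nat_eq0 => /forallP a0.
by apply/eqP/ffunP => i; rewrite ffunE; apply/eqP/(a0 i).
Qed.

Lemma finite_cpart q n : finite_set (cpart q n).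
Proof.
pose dec (b : {ffun 'I_q -> 'I_n.+1}) : {ffun 'I_q -> nat} := [ffun i => b i : nat].
pose enc (a : cvec q) : {ffun 'I_q -> 'I_n.+1} := [ffun i => inord (a i)].
pose D : seq (cvec q) := pmap insub [seq dec b | b : {ffun 'I_q -> 'I_n.+1}].
pose g (f : {ffun {ffun 'I_q -> 'I_n.+1} -> 'I_n.+1}) : {mset cvec q} :=
  [fsfun a in seq_fset tt D => f (enc a) : nat]%fset.
apply: (@sub_finite_set _ _ (range g)); last exact/finite_image/finite_finset.
move=> A An.
exists [ffun b => inord (if insub (dec b) is Some c then A c else 0)%N] => //.
apply/msetP => a; rewrite fsfunE seq_fsetE; case: ifPn => [|aD].
  rewrite mem_pmap_sub => /mapP[b _ ab]; rewrite ffunE.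
  have -> : enc a = b.
    apply/ffunP => i; apply/val_inj; rewrite /= ffunE -[cvec_val a]/(val a) ab.
    by rewrite ffunE inord_val.
  rewrite -ab valK inordK// ltnS -An (leq_trans _ (cweight_ge A a))//.
  by rewrite leq_pmulr// cvec_csize_gt0.
apply/esym/eqP; apply: contraR aD; rewrite -lt0n => Aa.
have an i : (a i < n.+1)%N.
  rewrite ltnS -An (leq_trans _ (cweight_ge A a))// (leq_trans _ (leq_pmull _ Aa))//.
  by rewrite /csize (bigD1 i)//= leq_addr.
rewrite mem_pmap_sub; apply/mapP; exists (enc a); first by rewrite mem_enum.
by apply/ffunP => i; rewrite !ffunE inordK.
Qed.

(** [P n] is a probability mass function on the finite set [cpart q n]
    ([finite_cpart]); its values outside [cpart q n] are irrelevant. *)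
Definition cpart_structure (R : realType) q (P : nat -> {mset cvec q} -> R) :=
  [/\ forall n A, cpart q n A -> 0 <= P n A,
      forall n, \sum_(A \in cpart q n) P n A = 1
    & forall n B, cpart q n B ->
        P n B = \sum_(A \in cpart q n.+1) P n.+1 A * ctrans R n.+1 A B].

Definition simplex (R : realType) (q : nat) : set 'rV[R]_q :=
  [set u | (forall j, 0 <= u ord0 j <= 1) /\ \sum_j u ord0 j = 1].
Arguments simplex R q : clear implicits.

(** The simplex with its subspace topology. The number of colours is a successor
    so that it is nonempty: measurable types are pointed. *)
Definition simplex_type (R : realType) (q : nat) : Type :=
  set_type (simplex R q.+1).

HB.instance Definition _ R q :=
  Topological.copy (simplex_type R q) (set_type (simplex R q.+1)).

Lemma simplex_vertex (R : realType) (q : nat) :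
  delta_mx ord0 ord0 \in simplex R q.+1.
Proof.
rewrite inE; split=> [j|].
  by rewrite mxE eqxx; case: (j == _); rewrite ?lexx ler01.
rewrite (bigD1 ord0)//= mxE !eqxx (eq_bigr (fun=> 0)) ?big1_eq ?addr0// => j.
by rewrite mxE => /negbTE ->; rewrite andbF.
Qed.

HB.instance Definition _ R q :=
  isPointed.Build (simplex_type R q)
    (exist (fun u => u \in simplex R q.+1) _ (simplex_vertex R q)).

(** The sigma-algebra of a probability on [borel_simplex R q] is generated by the
    open sets. A measure is a function on all sets, constrained on the measurable
    ones only, so equality of measures means agreement on measurable sets. *)
Definition borel_simplex (R : realType) (q : nat) :=
  g_sigma_algebraType (@open (simplex_type R q)).

Definition cmoment (R : realType) q (nu : probability (borel_simplex R q) R)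
    (a : {ffun 'I_q.+1 -> nat}) : R :=
  \int[nu]_(u in setT) \prod_j (set_val u ord0 j) ^+ a j.

Definition cmultinom (R : realType) q (a : {ffun 'I_q -> nat}) : R :=
  (csize a)`!%:R / \prod_j (a j)`!%:R.

Definition rising (R : realType) (theta : R) (n : nat) : R :=
  \prod_(i < n) (theta + i%:R).

Definition pESF (R : realType) q (theta : R)
    (nu : probability (borel_simplex R q) R) (n : nat)
    (A : {mset cvec q.+1}) : R :=
  n`!%:R / rising theta n *
  \prod_(a <- finsupp A)
    ((A a)`!%:R^-1
     * (theta / (csize a)%:R * cmultinom R a * cmoment nu a) ^+ A a).

(* Main.v *)
Require Import Defs.
From HB Require Import structures.
From mathcomp Require Import all_boot all_order all_algebra.
From mathcomp Require Import finmap multiset.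
From mathcomp Require Import all_classical all_reals all_analysis.
From mathcomp Require Import measurable_realfun.
From mathcomp Require Import ring lra.

(** A measure is recovered from the removal rates in two stages.

    Combinatorial stage. Removing two blocks in either order commutes
    ([rate_comm]), which forces the rates [b n r] to factor into a weight of the
    block and a ratio of a function of the size ([rateE]); hence [P] has a product
    form ([product_form]). Divided by [P B], the consistency relation at [B]
    becomes additive over the blocks of [B] ([consistency]). One block of size
    [n] and [n] blocks of size [1] have the same weight, so additivity makes the
    contribution of a block proportional to its size ([growthE]); the
    proportionality constant is [1 / theta], and it determines the function of the
    size ([rate_prodE]). What is left of consistency is the identity
    [m u = \sum_j m (u + e_j)] for the normalized weights [m] of the blocks
    ([sum_limit_moment]), which are the candidates for the moments of [nu].

    Analytic stage. An array with [m 0 = 1] and this identity is the moment array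
    of a unique probability on the simplex: this is the Hausdorff moment problem
    on the simplex, or de Finetti's theorem for colours.

    Existence ([moment_measure_exists]) follows de Finetti. The array defines an
    urn, in which after counts [a] the colour [j] is drawn with probability
    [m (a + e_j) / m a]; all draws are simulated by one uniform number, whose
    interval is cut again and again ([urn_contents_exist]). For each [u] the
    probability [m (a + u) / m a] that given draws with counts [u] come next is a
    bounded martingale, so its squared increments are summable; this makes the
    probabilities of the colours converge almost surely along a subsequence
    ([ae_cvg_summable_increments], [fast_subsequence]), and makes blocks of
    successive draws asymptotically independent ([cvg_after_prod]). The law of the
    limit therefore has the moments [m].

    Uniqueness ([moment_determinacy]): polynomials with values in [[0, 1]] converge
    pointwise to the indicators of the half-spaces [u j < t] ([cvg_step]), and
    these generate the Borel sets of the simplex ([measurable_simplex]).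

    Finally [theta] can be read off the masses of two multisets of unit blocks
    ([parameter_unique]), and then the moments off the one-block multisets
    ([cmoment_inj]). *)

Set Implicit Arguments.
Unset Strict Implicit.
Unset Printing Implicit Defensive.
Import Order.TTheory GRing.Theory Num.Theory.
Import numFieldNormedType.Exports.

Local Open Scope classical_set_scope.
Local Open Scope ring_scope.

(** * Vectors of colour counts *)

Section colour_counts.
Variable q : nat.
Implicit Types (u v : {ffun 'I_q -> nat}) (j : 'I_q).

Lemma csize0 : csize (0 : {ffun 'I_q -> nat}) = 0%N.
Proof. by rewrite /csize big1// => j _; rewrite ffunE. Qed.

Lemma csizeD u v : csize (u + v) = (csize u + csize v)%N.
Proof.
by rewrite /csize -big_split; apply: eq_bigr => j _; rewrite ffunE.
Qed.

Lemma csize_basis j : csize (cbasis j) = 1%N.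
Proof.
rewrite /csize (bigD1 j)//= big1 ?ffunE ?eqxx// => i /negbTE ij.
by rewrite ffunE ij.
Qed.

Lemma ffun_nat_ind (Q : {ffun 'I_q -> nat} -> Prop) :
  Q 0 -> (forall u j, Q u -> Q (u + cbasis j)) -> forall u, Q u.
Proof.
move=> Q0 QS u; have [n] := ubnP (csize u); elim: n u => // n ih u un.
have [->//|u0] := eqVneq u 0.
have /existsP[j uj] : [exists j, u j != 0%N].
  apply: contra_neqT u0; rewrite negb_exists => /forallP uz.
  by apply/ffunP => j; rewrite ffunE; have := uz j; rewrite negbK => /eqP.
pose v := [ffun i => (u i - cbasis j i)%N].
have uv : u = v + cbasis j.
  apply/ffunP => i; rewrite !ffunE; have [->|_] := eqVneq i j.
    by rewrite -[RHS]/(_ + _)%N subnK// lt0n.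
  by rewrite subn0 addr0.
rewrite uv; apply/QS/ih; move: un; rewrite uv csizeD csize_basis addn1.
by rewrite ltnS => /leq_trans; apply.
Qed.

Lemma add_basis_neq0 u j : u + cbasis j != 0.
Proof.
by apply/eqP => /(congr1 (@csize q)); rewrite csizeD csize_basis addn1 csize0.
Qed.

Definition grow u j : cvec q := Cvec (add_basis_neq0 u j).

Lemma grow_same u j : grow u j j = (u j).+1.
Proof. by rewrite !ffunE eqxx -[LHS]/((u j + 1)%N) addn1. Qed.

Lemma grow_other u i j : i != j -> grow u j i = u i.
Proof. by move=> /negbTE ij; rewrite !ffunE ij addr0. Qed.

Lemma csize_grow u j : csize (grow u j) = (csize u).+1.
Proof. by rewrite csizeD csize_basis addn1. Qed.

Lemma csize_grow0 j : csize (grow 0 j) = 1%N.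
Proof. by rewrite csize_grow csize0. Qed.

Lemma cmultinom_gt0 (R : realType) u : 0 < cmultinom R u.
Proof.
rewrite divr_gt0 ?ltr0n ?fact_gt0//; apply: prodr_gt0 => j _.
by rewrite ltr0n fact_gt0.
Qed.

Lemma cmultinom0 (R : realType) : cmultinom R (0 : {ffun 'I_q -> nat}) = 1.
Proof. by rewrite /cmultinom csize0 big1 ?divr1// => j _; rewrite ffunE. Qed.

Lemma cmultinomS (R : realType) u j :
  (u j).+1%:R * cmultinom R (grow u j) = (csize u).+1%:R * cmultinom R u.
Proof.
rewrite /cmultinom csize_grow factS natrM.
rewrite (bigD1 j)//= [in RHS](bigD1 j)//=.
set p := \prod_(i < _ | _) _; set p' := \prod_(i < _ | _) _.
have -> : p = p' by apply: eq_bigr => i ij; rewrite grow_other.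
rewrite grow_same factS natrM.
have p0 : p' != 0.
  by apply/prodf_neq0 => i _; rewrite pnatr_eq0 -lt0n fact_gt0.
by field; rewrite p0 nat1r !pnatr_eq0 -lt0n fact_gt0.
Qed.

End colour_counts.

(** * The Borel sets of the simplex *)

Definition coord (R : realType) q (u : borel_simplex R q) (j : 'I_q.+1) : R :=
  set_val u ord0 j.

Lemma measurable_coord (R : realType) q (j : 'I_q.+1) :
  measurable_fun setT (fun u : borel_simplex R q => coord u j).
Proof.
apply: (measurability _ (RGenInftyO.measurableE R)) => _ [_ [x ->] <-].
rewrite setTI; apply: sub_sigma_algebra.
exists [set v : 'rV[R]_q.+1 | v ord0 j < x]; last first.
  by apply/seteqP; split => u /=; rewrite in_itv.
rewrite (_ : mkset _ = (fun v : 'rV[R]_q.+1 => v ord0 j) @^-1` [set y | y < x])//.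
by apply: open_comp; [move=> v _; exact: coord_continuous|exact: open_lt].
Qed.

Lemma coordP (R : realType) q (u : borel_simplex R q) :
  (forall j, 0 <= coord u j <= 1) /\ \sum_j coord u j = 1.
Proof. by have := set_valP u. Qed.

(** Rational boxes form a countable base of the simplex, so an open set is a
    countable union of sets cut out by conditions on single coordinates. *)
Lemma measurable_simplex (R : realType) q d (T : measurableType d)
    (U : T -> borel_simplex R q) :
  (forall j, measurable_fun setT (fun x => coord (U x) j)) ->
  measurable_fun setT U.
Proof.
move=> mU.
apply: (@measurability _ _ _ (borel_simplex R q) _ _ (@open (simplex_type R q))) => //.
move=> _ [_ [W oW <-] <-]; rewrite setTI.
pose box (c : 'rV[rat]_q.+1 * nat) : set 'rV[R]_q.+1 :=
  [set v | forall j, `|v ord0 j - ratr (c.1 ord0 j)| < c.2.+1%:R^-1].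
have mbox c : measurable (U @^-1` (set_val @^-1` box c)).
  rewrite (_ : _ @^-1` _ = \bigcap_(j in [set: 'I_q.+1])
     (fun x => coord (U x) j) @^-1` (ball (ratr (c.1 ord0 j) : R) c.2.+1%:R^-1)).
    apply: fin_bigcap_measurable => // j _.
    by rewrite -[X in measurable X]setTI; apply: mU => //; exact: measurable_ball.
  apply/seteqP; split => x /=.
    by move=> h j _ /=; rewrite /ball/= distrC; exact: h.
  by move=> h j; rewrite distrC; exact: h.
have -> : U @^-1` (set_val @^-1` W) = \bigcup_c (if `[< box c `<=` W >] then
   U @^-1` (set_val @^-1` box c) else set0).
  apply/seteqP; split => x /=; last first.
    by move=> [c _]; case: ifPn => // /asboolP h /h.
  move=> Wx.
  have /nbhs_ballP[_/posnumP[e] eW] : nbhs (set_val (U x)) W by exact: open_nbhs_nbhs.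
  have e20 : 0 < e%:num / 2 by [].
  have [n] := ltr_add_invr e20; rewrite add0r => ne.
  have /choice[c cP] (j : 'I_q.+1) :
      exists r : rat, `|coord (U x) j - ratr r| < n.+1%:R^-1.
    have : coord (U x) j < coord (U x) j + n.+1%:R^-1 by rewrite ltrDl invr_gt0.
    move=> /rat_in_itvoo[r]; rewrite in_itv/= => /andP[r1 r2].
    exists r; rewrite distrC ltr_distl r2 andbT (lt_trans _ r1)//.
    by rewrite ltrBlDr ltrDl invr_gt0.
  have xbox : box (\row_j c j, n) (set_val (U x)).
    by move=> j /=; rewrite mxE; exact: cP.
  exists (\row_j c j, n) => //; case: ifPn => // /asboolP; case=> v bv.
  apply: eW; split=> // i j; rewrite !ord1 /ball/=.
  rewrite (le_lt_trans (ler_distD (ratr (c j)) _ _))// [ltRHS]splitr ltrD//.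
    exact: lt_trans (cP j) ne.
  by have := bv j; rewrite /= mxE distrC => /lt_trans; apply.
by apply: countable_bigcupT_measurable => // c; case: ifP.
Qed.

(** * Moments determine a measure on the simplex *)

Lemma integrable_bounded (R : realType) d (T : measurableType d)
    (P : probability T R) (f : T -> R) :
  measurable_fun setT f -> (forall x, `|f x| <= 1) ->
  P.-integrable setT (EFin \o f).
Proof.
move=> mf f1; apply: (@le_integrable _ _ _ _ _ _ _ (EFin \o cst 1)) => //.
- exact/measurable_EFinP.
- by move=> x _ /=; rewrite lee_fin normr1.
- exact: finite_measure_integrable_cst.
Qed.

Lemma bounded_convergence (R : realType) d (T : measurableType d)
    (P : probability T R) (f_ : (T -> R)^nat) (f : T -> R) :
  (forall n, measurable_fun setT (f_ n)) -> measurable_fun setT f ->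
  (forall n x, `|f_ n x| <= 1) ->
  {ae P, forall x, f_ n x @[n --> \oo] --> f x} ->
  (\int[P]_x (f_ n x)%:E @[n --> \oo] --> \int[P]_x (f x)%:E)%E.
Proof.
move=> mf_ mf f_1 f_f.
have [] := @dominated_convergence _ _ _ P setT measurableT
  (fun n x => (f_ n x)%:E) (fun x => (f x)%:E) (cst 1%E) => //.
- by move=> n; exact/measurable_EFinP.
- exact/measurable_EFinP.
- by apply: filterS f_f => x fx _; apply: cvg_EFin => //; exact: nearW.
- exact: finite_measure_integrable_cst.
- by apply: aeW => x n _; rewrite lee_fin.
Qed.

Definition step_exponent (R : realType) (t : R) n : nat :=
  (n * `|Num.ceil (t ^- n)|)%N.

Lemma mulrn_exp_le (R : realType) (z w : R) n : 0 <= z <= w ->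
  n%:R * z ^+ n * (w - z) <= w ^+ n.+1.
Proof.
move=> /andP[z0 zw]; elim: n => [|n ih].
  by rewrite mul0r mul0r expr1 (le_trans z0).
have -> : n.+1%:R * z ^+ n.+1 * (w - z) =
  z * (n%:R * z ^+ n * (w - z)) + z ^+ n.+1 * (w - z).
  by rewrite -natr1 exprS; ring.
apply: (@le_trans _ _ (z * w ^+ n.+1 + w ^+ n.+1 * (w - z))); last first.
  by rewrite [w ^+ n.+2]exprS; lra.
by rewrite lerD ?ler_wpM2l// ler_wpM2r ?subr_ge0// lerXn2r// nnegrE (le_trans z0).
Qed.

Lemma cvg_mulrn_exp (R : realType) (z : R) : 0 <= z < 1 ->
  n%:R * z ^+ n @[n --> \oo] --> 0.
Proof.
move=> /andP[z0 z1]; pose w := (1 + z) / 2.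
have zw : z < w by rewrite /w; lra.
have w1 : w < 1 by rewrite /w; lra.
have w0 : 0 <= w by rewrite (le_trans z0)// ltW.
apply: (@squeeze_cvgr _ _ _ _ (cst 0) (fun n => w / (w - z) * w ^+ n)).
- near=> n; rewrite mulr_ge0 ?exprn_ge0//= mulrAC ler_pdivlMr ?subr_gt0//.
  by rewrite -exprS mulrn_exp_le// z0 ltW.
- exact: cvg_cst.
- rewrite -[X in _ --> X](mulr0 (w / (w - z))); apply: cvgMr.
  by apply: cvg_expr; rewrite ger0_norm.
Unshelve. all: by end_near. Qed.

Lemma exp_onem_ge (R : realType) (y : R) k : 0 <= y <= 1 ->
  1 - k%:R * y <= (1 - y) ^+ k.
Proof.
move=> /andP[y0 y1]; elim: k => [|k ih]; first by rewrite mul0r subr0 expr0.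
rewrite exprS (le_trans _ (ler_wpM2l _ ih)) ?subr_ge0//.
rewrite -natr1 -subr_ge0 (_ : _ - _ = k%:R * y ^+ 2); last by ring.
by rewrite mulr_ge0// exprn_ge0.
Qed.

Lemma exp_onem_le (R : realType) (y : R) k : 0 <= y <= 1 ->
  (1 - y) ^+ k <= (1 + k%:R * y)^-1.
Proof.
move=> /andP[y0 y1]; rewrite -[leRHS]mul1r ler_pdivlMr; last first.
  by rewrite ltr_wpDr// mulr_ge0.
elim: k => [|k ih]; first by rewrite expr0 mul0r addr0 mulr1.
apply: le_trans ih; rewrite exprS mulrAC mulrC ler_wpM2l ?exprn_ge0 ?subr_ge0//.
rewrite -natr1 -subr_ge0 (_ : _ - _ = (k%:R + 1) * y ^+ 2); last by ring.
by rewrite mulr_ge0 ?exprn_ge0// addr_ge0.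
Qed.

(** For [x < t] the exponent times [x ^+ n] tends to [0], for [t <= x] it tends to
    infinity. The factor [n] in the exponent matters at [x = t], where the limit
    could otherwise be positive. *)
Lemma cvg_step (R : realType) (t x : R) : 0 < t <= 1 -> 0 <= x <= 1 ->
  (1 - x ^+ n) ^+ step_exponent t n @[n --> \oo] --> ((x < t)%R%:R : R).
Proof.
move=> /andP[t0 t1] /andP[x0 x1].
have xn n : 0 <= x ^+ n <= 1 by rewrite exprn_ge0// exprn_ile1.
have K1 n : n%:R / t ^+ n <= (step_exponent t n)%:R.
  rewrite natrM ler_wpM2l// natr_absz ger0_norm ?ceil_ge//.
  by rewrite -(ler_int R) (le_trans _ (ceil_ge _))// invr_ge0 exprn_ge0// ltW.
have K2 n : (step_exponent t n)%:R <= 2 * (n%:R / t ^+ n).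
  rewrite natrM mulrCA ler_wpM2l// natr_absz ger0_norm; last first.
    by rewrite -(ler_int R) (le_trans _ (ceil_ge _))// invr_ge0 exprn_ge0// ltW.
  have : (1 : R) <= (t ^+ n)^-1 by rewrite invf_ge1 ?exprn_gt0// exprn_ile1// ltW.
  have := ceilB1_lt (t ^- n); rewrite intrB/=; lra.
have [xt|tx] := ltP x t.
- apply: (@squeeze_cvgr _ _ _ _ (fun n => 1 - 2 * (n%:R * (x / t) ^+ n)) (cst 1)).
  + near=> n; apply/andP; split; last first.
      by apply: exprn_ile1; rewrite ?subr_ge0 ?gerBl; case/andP: (xn n).
    apply: le_trans (exp_onem_ge _ (xn n)); rewrite lerD2l lerN2.
    have /andP[xn0 _] := xn n.
    rewrite (le_trans (ler_wpM2r xn0 (K2 n)))// expr_div_n.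
    by rewrite le_eqVlt; apply/orP; left; apply/eqP; ring.
  + rewrite -[X in _ --> X]subr0 -[X in _ - X](mulr0 2).
    apply: cvgB; first exact: cvg_cst.
    apply: cvgMr; apply: cvg_mulrn_exp.
    by rewrite divr_ge0 ?(ltW t0)//= ltr_pdivrMr// mul1r.
  + exact: cvg_cst.
- apply: (@squeeze_cvgr _ _ _ _ (cst 0) (fun n => n.+1%:R^-1)).
  + near=> n; rewrite exprn_ge0/=; last by rewrite subr_ge0; case/andP: (xn n).
    apply: le_trans (exp_onem_le _ (xn n)) _.
    rewrite lef_pV2 ?posrE//; last by rewrite ltr_wpDr// mulr_ge0//; case/andP: (xn n).
    rewrite -natr1 addrC lerD2l.
    apply: (@le_trans _ _ (n%:R / t ^+ n * x ^+ n)); last first.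
      by rewrite ler_wpM2r//; case/andP: (xn n).
    rewrite mulrAC ler_pdivlMr ?exprn_gt0// ler_wpM2l// lerXn2r// nnegrE ltW//.
  + exact: cvg_cst.
  + exact: cvg_harmonic.
Unshelve. all: by end_near. Qed.

Definition monomial (R : realType) q (a : {ffun 'I_q.+1 -> nat})
    (u : borel_simplex R q) : R := \prod_j coord u j ^+ a j.

Lemma measurable_monomial (R : realType) q (a : {ffun 'I_q.+1 -> nat}) :
  measurable_fun setT (@monomial R q a).
Proof.
apply: measurable_prod => j _.
by apply: (measurableT_comp (exprn_measurable (a j))); exact: measurable_coord.
Qed.

Lemma monomial_itv (R : realType) q a (u : borel_simplex R q) :
  0 <= monomial a u <= 1.
Proof.
have [u01 _] := coordP u; apply/andP; split.
  by apply: prodr_ge0 => j _; rewrite exprn_ge0//; case/andP: (u01 j).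
apply: prodr_ile1 => j _; have /andP[u0 u1] := u01 j.
by rewrite exprn_ge0// exprn_ile1.
Qed.

Lemma monomialD (R : realType) q (a b : {ffun _}) (u : borel_simplex R q) :
  monomial [ffun i => (a i + b i)%N] u = monomial a u * monomial b u.
Proof.
by rewrite /monomial -big_split; apply: eq_bigr => j _; rewrite ffunE exprD.
Qed.

Lemma norm_mul_le1 (R : numDomainType) (x y : R) :
  `|x| <= 1 -> `|y| <= 1 -> `|x * y| <= 1.
Proof. by move=> x1 y1; rewrite normrM mulr_ile1. Qed.

Section moment_determinacy.
Variables (R : realType) (q : nat) (nu nu' : probability (borel_simplex R q) R).
Hypothesis eq_moment : forall a, cmoment nu a = cmoment nu' a.

(** Weighting by all monomials, rather than only integrating, makes this class
    stable under multiplication by monomials, hence by the polynomials of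
    [cvg_step]. *)
Definition same_moments (f : borel_simplex R q -> R) :=
  [/\ measurable_fun setT f, forall u, `|f u| <= 1 &
  forall a, (\int[nu]_u (monomial a u * f u)%:E =
             \int[nu']_u (monomial a u * f u)%:E)%E].

Lemma monomial_norm a (u : borel_simplex R q) : `|monomial a u| <= 1.
Proof. by have /andP[m0 m1] := monomial_itv a u; rewrite ger0_norm. Qed.

Lemma same_moments1 : same_moments (cst 1).
Proof.
split; [exact: measurable_cst|by move=> u; rewrite /= normr1|move=> a].
have int (P : probability (borel_simplex R q) R) :
    P.-integrable setT (EFin \o monomial a).
  apply: integrable_bounded => [|u]; first exact: measurable_monomial.
  exact: monomial_norm.
have E (P : probability (borel_simplex R q) R) :
    (\int[P]_u (monomial a u * cst 1 u)%:E = (cmoment P a)%:E)%E.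
  rewrite /cmoment /Rintegral fineK; last first.
    exact: (integrable_fin_num measurableT (int P)).
  by apply: eq_integral => u _; rewrite /= mulr1.
by rewrite !E eq_moment.
Qed.

Lemma same_momentsB f g : same_moments f -> same_moments g ->
  (forall u, `|f u - g u| <= 1) -> same_moments (fun u => f u - g u).
Proof.
move=> [mf f1 Ef] [mg g1 Eg] fg1; split => // [|a]; first exact: measurable_funB.
have int (P : probability (borel_simplex R q) R) (h : _ -> R) : measurable_fun setT h ->
    (forall u, `|h u| <= 1) ->
    P.-integrable setT (EFin \o (fun u => monomial a u * h u)).
  move=> mh h1; apply: integrable_bounded => [|u].
    by apply: measurable_funM => //; exact: measurable_monomial.
  by apply: norm_mul_le1 => //; exact: monomial_norm.
have E (P : probability (borel_simplex R q) R) :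
    (\int[P]_u (monomial a u * (f u - g u))%:E =
     \int[P]_u (monomial a u * f u)%:E - \int[P]_u (monomial a u * g u)%:E)%E.
  rewrite -integralB_EFin//; [|exact: int..].
  by apply: eq_integral => u _; rewrite -EFinB mulrBr.
by rewrite !E Ef Eg.
Qed.

Lemma same_momentsM f b :
  same_moments f -> same_moments (fun u => monomial b u * f u).
Proof.
move=> [mf f1 Ef]; split.
- by apply: measurable_funM => //; exact: measurable_monomial.
- by move=> u; apply: norm_mul_le1 => //; exact: monomial_norm.
- move=> a; have := Ef [ffun i => (a i + b i)%N].
  by under eq_integral do rewrite monomialD -mulrA;
     under [X in _ = X -> _]eq_integral do rewrite monomialD -mulrA.
Qed.

Lemma same_moments_cvg (f_ : (borel_simplex R q -> R)^nat) f :
  (forall n, same_moments (f_ n)) ->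
  (forall u, f_ n u @[n --> \oo] --> f u) -> same_moments f.
Proof.
move=> sf ff.
have mf : measurable_fun setT f.
  by apply: (@measurable_fun_cvg _ _ _ _ f_) => [n|u _]; [case: (sf n)|exact: ff].
have f1 u : `|f u| <= 1.
  have /cvg_norm ffu := ff u.
  by apply: (cvgr_to_le ffu); apply: nearW => n; case: (sf n).
split=> // a.
have E (P : probability (borel_simplex R q) R) :
    (\int[P]_u (monomial a u * f_ n u)%:E @[n --> \oo] -->
     \int[P]_u (monomial a u * f u)%:E)%E.
  apply: bounded_convergence.
  - move=> n; case: (sf n) => mfn _ _; apply: measurable_funM => //.
    exact: measurable_monomial.
  - by apply: measurable_funM => //; exact: measurable_monomial.
  - move=> n u; case: (sf n) => _ fn1 _; apply: norm_mul_le1 => //.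
    exact: monomial_norm.
  - by apply: aeW => u; apply: cvgMr; exact: ff.
apply: (cvg_unique _ (E nu)) => //.
have -> : (fun n => \int[nu]_u (monomial a u * f_ n u)%:E)%E =
          (fun n => \int[nu']_u (monomial a u * f_ n u)%:E)%E.
  by apply/funext => n; case: (sf n).
exact: E.
Qed.

(** Asking for multipliers of the class, rather than for indicators in the class,
    gives stability under intersections, so that these sets form a sigma-algebra
    without any recourse to pi-systems. *)
Definition cutting (B : set (borel_simplex R q)) :=
  forall f, same_moments f -> same_moments (fun u => \1_B u * f u).

Lemma cutting_sigma_algebra : sigma_algebra setT cutting.
Proof.
have cutC : forall B, cutting B -> cutting (~` B).
  move=> B cB f sf; have := same_momentsB sf (cB _ sf).
  rewrite (_ : (fun u => f u - _) = (fun u => \1_(~` B) u * f u)).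
    apply => u; case: sf => _ f1 _; rewrite -[X in X - _]mul1r -mulrBl.
    by apply: norm_mul_le1 => //; rewrite indicE; case: (_ \in _);
      rewrite ?subrr ?subr0 ?normr0 ?normr1.
  apply/funext => u; rewrite !indicE in_setC; case: (_ \in _) => /=;
  by rewrite ?mul1r ?mul0r ?subr0 ?subrr.
have cutI : forall A B, cutting A -> cutting B -> cutting (A `&` B).
  move=> A B cA cB f /cB/cA; congr same_moments; apply/funext => u.
  by rewrite indicI mulrA.
have cut0 : cutting set0.
  move=> f sf; have := same_momentsB sf sf.
  rewrite (_ : (fun=> _) = (fun u => \1_set0 u * f u)).
    by apply => u; rewrite subrr normr0.
  by apply/funext => u; rewrite indic0 mul0r subrr.
split=> // [A cA|F cF f sf]; first by rewrite setTD; exact: cutC.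
have cutU n : cutting (\bigcup_(i < n) F i).
  rewrite -[X in cutting X]setCK setC_bigcup; apply: (cutC).
  rewrite bigcap_mkord; elim: n => [|n ih].
    by rewrite big_ord0 -setC0; exact: cutC.
  by rewrite big_ord_recr/=; apply: cutI => //; exact: cutC.
apply: (@same_moments_cvg (fun n u => \1_(\bigcup_(i < n) F i) u * f u)) => [n|u].
  exact: cutU.
apply: cvgMl; rewrite indicE; have [|] := boolP (u \in \bigcup_k F k).
  rewrite inE => -[k _ Fku]; apply: cvg_near_cst; near=> n.
  rewrite indicE mem_set//; exists k => //=; near: n; exact: nbhs_infty_gt.
move=> nF; apply: cvg_near_cst; apply: nearW => n; rewrite indicE memNset//.
by move=> [k _ Fku]; move: nF; rewrite notin_setE; apply; exists k.
Unshelve. all: by end_near. Qed.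

(** The indicator of a half-space is a limit of polynomials by [cvg_step]; the
    thresholds outside [[0, 1]] cut out nothing or everything. *)
Lemma cutting_halfspace j (t : R) : cutting [set u | coord u j < t].
Proof.
have [cut0 cutC _] := cutting_sigma_algebra.
have [t0|t0] := leP t 0.
  rewrite (_ : mkset _ = set0)//; apply/seteqP; split => u //=.
  by have [/(_ j)/andP[u0 _] _] := coordP u; rewrite ltNge (le_trans t0).
have [t1|t1] := leP t 1; last first.
  have := cutC _ cut0; rewrite setTD setC0 (_ : mkset _ = setT)//.
  apply/seteqP; split => u //= _.
  by have [/(_ j)/andP[_ u1] _] := coordP u; rewrite (le_lt_trans u1).
move=> f sf; pose g n K u := (1 - coord u j ^+ n) ^+ K * f u.
have mon n u : coord u j ^+ n = monomial [ffun i => ((i == j) * n)%N] u.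
  rewrite /monomial (bigD1 j)//= big1 ?ffunE ?eqxx ?mul1n ?mulr1// => i /negbTE ij.
  by rewrite ffunE ij.
have sg n K : same_moments (g n K).
  elim: K => [|K ih].
    by move: sf; congr same_moments; apply/funext => u; rewrite /g mul1r.
  have := same_momentsB ih (same_momentsM [ffun i => ((i == j) * n)%N] ih).
  rewrite (_ : (fun u => _ - _) = g n K.+1); last first.
    by apply/funext => u; rewrite /g -mon exprS; ring.
  apply=> u; rewrite -[X in X - _]mul1r -mulrBl; apply: norm_mul_le1.
    by have /andP[m0 m1] := monomial_itv [ffun i => ((i == j) * n)%N] u;
      rewrite ger0_norm ?subr_ge0// gerBl.
  by case: ih.
apply: (@same_moments_cvg (fun n => g n (step_exponent t n))) => // u.
apply: cvgMl; rewrite indicE.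
rewrite (_ : (u \in _) = (coord u j < t)%R); last by apply/idP/idP; rewrite inE.
by apply: cvg_step; [rewrite t0|have [] := coordP u].
Qed.

Lemma moment_determinacy B : measurable B -> nu B = nu' B.
Proof.
move=> mB; have cB : cutting B.
  rewrite -(sigma_algebra_id cutting_sigma_algebra).
  have mid : measurable_fun setT
      (id : g_sigma_algebraType cutting -> borel_simplex R q).
    apply: measurable_simplex => j.
    apply: (measurability _ (RGenInftyO.measurableE R)) => _ [_ [x ->] <-].
    rewrite setTI; apply: sub_sigma_algebra.
    rewrite (_ : _ @^-1` _ = [set u | coord u j < x]).
      exact: cutting_halfspace.
    by apply/seteqP; split => u /=; rewrite in_itv.
  by have := mid measurableT B mB; rewrite setTI.
have [_ _ /(_ 0)] := cB _ same_moments1.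
have E (P : probability (borel_simplex R q) R) :
    (\int[P]_u (monomial 0 u * (\1_B u * cst 1 u))%:E = P B)%E.
  rewrite -[in RHS](setIT B) -integral_indic//; apply: eq_integral => u _.
  rewrite mulr1 /monomial big1 ?mul1r// => j _.
  by rewrite ffunE expr0.
by rewrite !E.
Qed.

End moment_determinacy.

(** * A projective array of moments comes from a measure *)

Lemma is_cvg_summable_increments (R : realType) (u : R^nat) :
  (\sum_(k <oo) (`|u k.+1 - u k|)%:E < +oo)%E -> cvgn u.
Proof.
move=> uoo; have cu : cvgn (series (telescope u)).
  apply: (@normed_cvg _ R^o); apply: nondecreasing_is_cvgn.
    by apply: nondecreasing_series => n _ _; exact: normr_ge0.
  exists (fine (\sum_(k <oo) (`|u k.+1 - u k|)%:E)%E) => _ [n _ <-].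
  have u0 : (0 <= \sum_(k <oo) (`|u k.+1 - u k|)%:E)%E.
    by apply: nneseries_ge0 => k _ _; rewrite lee_fin.
  rewrite -lee_fin fineK ?ge0_fin_numE// /series/= -sumEFin.
  by apply: nneseries_lim_ge => k _; rewrite lee_fin.
rewrite (_ : u = (fun n => u 0%N + series (telescope u) n)).
  by apply: is_cvgD => //; exact: is_cvg_cst.
by apply/funext => n; exact: eq_sum_telescope.
Qed.

(** The total variation of the sequence has a finite expectation, so it is almost
    surely finite. *)
Lemma ae_cvg_summable_increments (R : realType) d (T : measurableType d)
    (P : probability T R) (u : (T -> R)^nat) :
  (forall k, measurable_fun setT (u k)) ->
  (forall k, \int[P]_x (`|u k.+1 x - u k x|)%:E <= (1 / (2 ^ (k + 1))%:R)%:E)%E ->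
  {ae P, forall x, cvgn (u ^~ x)}.
Proof.
move=> mu int_u; pose f k x := (`|u k.+1 x - u k x|)%:E.
have f0 k x : (0 <= f k x)%E by rewrite lee_fin.
have mf k : measurable_fun setT (f k).
  by apply/measurable_EFinP/measurableT_comp => //; exact: measurable_funB.
have : P.-integrable setT (fun x => \sum_(k <oo) f k x)%E.
  apply/integrableP; split; first exact: ge0_emeasurable_sum.
  under eq_integral do rewrite gee0_abs ?nneseries_ge0//.
  rewrite integral_nneseries//.
  apply: (@le_lt_trans _ _ (\sum_(k <oo) (1 / (2 ^ (k + 1))%:R : R)%:E)%E).
    apply: lee_nneseries => [k _ _|k _]; [exact: integral_ge0|exact: int_u].
  by have /cvg_lim -> := @cvg_geometric_eseries_half R 1 0; rewrite ?ltry.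
move=> /(integrable_ae measurableT); apply: filterS => x /(_ I) fx.
by apply: is_cvg_summable_increments; rewrite ltey_eq fx.
Qed.

Section urn.
Variables (R : realType) (q : nat) (m : {ffun 'I_q.+1 -> nat} -> R).
Hypothesis m_gt0 : forall a, 0 < m a.
Hypothesis mS : forall a, \sum_j m (a + cbasis j) = m a.

(** Mean of [f] after one draw, when the colours drawn so far have counts [a] and
    the next one is [j] with probability [m (a + cbasis j) / m a]. *)
Definition draw (f : {ffun 'I_q.+1 -> nat} -> R) a : R :=
  \sum_j m (a + cbasis j) / m a * f (a + cbasis j).

Definition after n f : R := iter n draw f 0.

(** The probability that, after counts [a], the next draws are a given sequence of
    colours with counts [b]; the order of the colours is immaterial. *)
Definition block_prob b a : R := m (a + b) / m a.

Lemma sum_draw_prob a : \sum_j m (a + cbasis j) / m a = 1.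
Proof. by rewrite -mulr_suml mS mulfV// gt_eqF. Qed.

Lemma draw_prob_ge0 a b : 0 <= m b / m a.
Proof. by rewrite divr_ge0// ltW. Qed.

Lemma iter_draw_le n f g : (forall a, f a <= g a) ->
  forall a, iter n draw f a <= iter n draw g a.
Proof.
move=> fg; elim: n => //= n ih a.
by apply: ler_sum => j _; rewrite ler_wpM2l ?draw_prob_ge0.
Qed.

Lemma norm_iter_draw n f g : (forall a, `|f a| <= g a) ->
  forall a, `|iter n draw f a| <= iter n draw g a.
Proof.
move=> fg; elim: n => //= n ih a; apply: (le_trans (ler_norm_sum _ _ _)).
apply: ler_sum => j _; rewrite normrM ger0_norm ?draw_prob_ge0//.
by rewrite ler_wpM2l ?draw_prob_ge0.
Qed.

Lemma iter_drawD n f g c a :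
  iter n draw (fun b => f b + c * g b) a = iter n draw f a + c * iter n draw g a.
Proof.
elim: n a => //= n ih a; rewrite /draw mulr_sumr -big_split; apply: eq_bigr => j _.
by rewrite ih /=; ring.
Qed.

Lemma iter_draw_cst n c a : iter n draw (cst c) a = c.
Proof.
elim: n a => //= n ih a; rewrite /draw; under eq_bigr do rewrite ih.
by rewrite -mulr_suml sum_draw_prob mul1r.
Qed.

(** [block_prob b] is a martingale: this is the projectivity [mS] at [a + b]. *)
Lemma draw_block_prob b : draw (block_prob b) = block_prob b.
Proof.
apply/funext => a; rewrite /draw /block_prob -(mS (a + b)) mulr_suml.
apply: eq_bigr => j _.
by rewrite (addrAC a); field; rewrite !gt_eqF.
Qed.

Lemma iter_draw_block_prob n b : iter n draw (block_prob b) = block_prob b.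
Proof. by elim: n => //= n ->; exact: draw_block_prob. Qed.

Lemma block_probD a b j : block_prob (b + cbasis j) a =
  block_prob (cbasis j) a * block_prob b (a + cbasis j).
Proof.
by rewrite /block_prob -addrA (addrC (cbasis j)); field; rewrite !gt_eqF.
Qed.

Lemma block_prob0 a : block_prob 0 a = 1.
Proof. by rewrite /block_prob addr0 mulfV// gt_eqF. Qed.

Lemma block_prob_ge0 b a : 0 <= block_prob b a.
Proof. exact: draw_prob_ge0. Qed.

Lemma block_prob_basis_le1 j a : block_prob (cbasis j) a <= 1.
Proof.
rewrite -(sum_draw_prob a) (bigD1 j)//= lerDl; apply: sumr_ge0 => i _.
exact: draw_prob_ge0.
Qed.

Lemma block_prob_le1 b a : block_prob b a <= 1.
Proof.
elim/ffun_nat_ind: b a => [|b j ih] a; first by rewrite block_prob0.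
by rewrite block_probD mulr_ile1 ?block_prob_ge0 ?block_prob_basis_le1.
Qed.

Definition second_moment b n : R := after n (fun a => block_prob b a ^+ 2).

(** Orthogonality of the increments of the martingale [block_prob b]. *)
Lemma after_sqr_increment b n k :
  after n (fun a => iter k draw (fun a' => (block_prob b a' - block_prob b a) ^+ 2) a) =
  second_moment b (n + k) - second_moment b n.
Proof.
rewrite /second_moment /after iterD.
have -> : (fun a => iter k draw (fun a' => (block_prob b a' - block_prob b a) ^+ 2) a) =
  (fun a => iter k draw (fun a' => block_prob b a' ^+ 2) a +
    (-1) * block_prob b a ^+ 2).
  apply/funext => a.
  rewrite (_ : (fun a' => _) = (fun a' => (block_prob b a' ^+ 2 +
      (- 2 * block_prob b a) * block_prob b a') + block_prob b a ^+ 2 * cst 1 a')).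
    by rewrite !iter_drawD iter_draw_cst iter_draw_block_prob; ring.
  by apply/funext => a' /=; ring.
by rewrite iter_drawD mulN1r.
Qed.

Lemma after_ge0 n f : (forall a, 0 <= f a) -> 0 <= after n f.
Proof.
by move=> f0; rewrite -[leLHS](iter_draw_cst n 0 0) iter_draw_le.
Qed.

Lemma second_moment_nondecreasing b : nondecreasing_seq (second_moment b).
Proof.
apply/nondecreasing_seqP => n; rewrite -addn1 -subr_ge0 -after_sqr_increment.
apply: after_ge0 => a; rewrite -[leLHS](iter_draw_cst 1 0 a); apply: iter_draw_le.
by move=> a'; exact: sqr_ge0.
Qed.

Lemma is_cvg_second_moment b : cvgn (second_moment b).
Proof.
apply: nondecreasing_is_cvgn; first exact: second_moment_nondecreasing.
exists 1 => _ [n _ <-]; rewrite -[leRHS](iter_draw_cst n 1 0); apply: iter_draw_le => a.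
by rewrite exprn_ile1 ?block_prob_ge0 ?block_prob_le1.
Qed.

Definition increment b n : R :=
  after n (fun a => draw (fun a' => `|block_prob b a' - block_prob b a|) a).

(** Expand [(e - |x|) ^+ 2 >= 0]; this bounds first moments by second moments. *)
Lemma norm_le_sqr (e x : R) : 0 < e -> `|x| <= (e + x ^+ 2 / e) / 2.
Proof.
move=> e0; rewrite -subr_ge0 -real_normK ?num_real//.
rewrite (_ : _ - _ = (e - `|x|) ^+ 2 / e / 2); last by field; rewrite gt_eqF.
by rewrite !divr_ge0 ?sqr_ge0// ltW.
Qed.

Lemma after_norm_increment b n k (e : R) : 0 < e ->
  after n (fun a => iter k draw (fun a' => `|block_prob b a' - block_prob b a|) a) <=
  (e + (second_moment b (n + k) - second_moment b n) / e) / 2.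
Proof.
move=> e0; rewrite -after_sqr_increment.
have -> : (e + after n (fun a =>
   iter k draw (fun a' => (block_prob b a' - block_prob b a) ^+ 2) a) / e) / 2 =
   after n (fun a => iter k draw (fun a' => cst (e / 2) a' + (2 * e)^-1 *
     (block_prob b a' - block_prob b a) ^+ 2) a).
  under [in RHS]eq_fun do rewrite iter_drawD iter_draw_cst.
  by rewrite /after iter_drawD iter_draw_cst; field; rewrite gt_eqF.
apply: iter_draw_le => a; apply: iter_draw_le => a'.
by rewrite (le_trans (norm_le_sqr _ e0))// le_eqVlt; apply/orP; left; apply/eqP;
  rewrite /=; field; rewrite gt_eqF.
Qed.

Lemma cvg_increment b : increment b n @[n --> \oo] --> 0.
Proof.
have inc0 n : 0 <= increment b n.
  by apply: after_ge0 => a; apply: sumr_ge0 => j _; rewrite mulr_ge0 ?draw_prob_ge0.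
apply/cvgr0Pnorm_lt => e e0; have sm := @is_cvg_second_moment b.
have d0 : second_moment b n.+1 - second_moment b n @[n --> \oo] --> 0.
  rewrite -(subrr (limn (second_moment b))); apply: cvgB => //.
  by rewrite cvg_shiftS.
have e20 : 0 < e ^+ 2 by rewrite exprn_gt0.
near=> n; rewrite ger0_norm//.
apply: (le_lt_trans (after_norm_increment b n 1 e0)); rewrite addn1.
rewrite ltr_pdivrMr// mulr_natr mulr2n ltrD2l ltr_pdivrMr// -expr2.
rewrite (le_lt_trans (ler_norm _))//; near: n.
by move/cvgr0Pnorm_lt : d0; apply.
Unshelve. all: by end_near. Qed.

(** Asymptotic independence of successive draws: by [block_probD] the probability
    of a block [c + cbasis j] is that of the colour [j] times that of [c] one step
    later, and [block_prob c] hardly changes in one step, by [cvg_increment]. Thus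
    one factor after the other can be moved into the block, whose mean after [n]
    draws does not depend on [n]. *)
Lemma cvg_after_prod (b c : {ffun 'I_q.+1 -> nat}) :
  after n (fun a => (\prod_j block_prob (cbasis j) a ^+ b j) * block_prob c a)
    @[n --> \oo] --> m (b + c) / m 0.
Proof.
elim/ffun_nat_ind: b c => [|b j ih] c.
  rewrite (_ : (fun n => _) = cst (m (0 + c) / m 0)); first exact: cvg_cst.
  apply/funext => n; rewrite /after (_ : (fun a => _) = block_prob c).
    by rewrite iter_draw_block_prob /block_prob addrC.
  by apply/funext => a; rewrite big1 ?mul1r// => i _; rewrite ffunE expr0.
have ihc := ih (c + cbasis j); rewrite (_ : b + _ + c = b + (c + cbasis j)); last first.
  by rewrite -addrA (addrC c).
set F := (fun n => after n _); set G := (fun n => after n _) in ihc.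
rewrite (_ : F = (F \- G) \+ G); last by apply/funext => n /=; rewrite subrK.
rewrite -[X in _ --> X]add0r; apply: cvgD ihc.
apply: norm_cvg0; apply: (squeeze_cvgr _ (cvg_cst 0) (@cvg_increment c)).
apply: nearW => n; rewrite normr_ge0 /= -mulN1r /F /G /after -iter_drawD.
apply: norm_iter_draw => a; rewrite block_probD.
pose p := \prod_i block_prob (cbasis i) a ^+ b i.
have -> : \prod_i block_prob (cbasis i) a ^+ (b + cbasis j)%R i =
    p * block_prob (cbasis j) a.
  rewrite /p [in RHS](bigD1 j)//= (bigD1 j)//= !ffunE eqxx exprD expr1 mulrAC.
  congr (_ * _ * _); apply: eq_bigr => i /negbTE ij.
  by rewrite !ffunE ij addr0.
have p01 : 0 <= p <= 1.
  rewrite prodr_ge0/= => [|i _]; last by rewrite exprn_ge0 ?block_prob_ge0.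
  apply: prodr_ile1 => i _.
  by rewrite exprn_ge0 ?exprn_ile1 ?block_prob_ge0 ?block_prob_le1.
have /andP[p0 p1] := p01.
rewrite -/p; clearbody p.
rewrite (_ : _ + _ = p * (block_prob (cbasis j) a *
    (block_prob c a - block_prob c (a + cbasis j)))); last by ring.
rewrite normrM (ger0_norm p0) (le_trans (ler_piMl _ p1))//.
rewrite normrM ger0_norm ?block_prob_ge0// distrC /draw (bigD1 j)//= lerDl.
by apply: sumr_ge0 => i _; rewrite mulr_ge0 ?draw_prob_ge0.
Qed.

(** Drawing from the urn is simulated by one uniform number [x]: a state [(a, l)]
    stands for the interval [[l, l + m a[] of those [x] that produce a certain
    sequence of colours with counts [a]; its children, one for each colour [j], cut
    it into consecutive intervals of length [m (a + cbasis j)]. *)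
Definition state : Type := {ffun 'I_q.+1 -> nat} * R.

Definition cut (s : state) k : R :=
  s.2 + \sum_(i < q.+1 | (i < k)%N) m (s.1 + cbasis i).

Definition child (s : state) j : state := (s.1 + cbasis j, cut s j).

Definition state_itv (s : state) : set R := `[s.2, s.2 + m s.1[%classic.

Definition step x (s : state) : state :=
  child s (odflt ord0 [pick j | x \in state_itv (child s j)]).

Lemma cutS s (j : 'I_q.+1) : cut s j.+1 = cut s j + m (s.1 + cbasis j).
Proof.
rewrite /cut -addrA; congr (_ + _); rewrite (bigD1 j)//= addrC; congr (_ + _).
apply: eq_bigl => i; rewrite ltnS ltn_neqAle andbC.
by rewrite -(inj_eq val_inj).
Qed.

Lemma cut_le s k l : (k <= l)%N -> cut s k <= cut s l.
Proof.
move=> kl; rewrite /cut lerD2l [leRHS](bigID (fun i : 'I__ => (i < k)%N))/=.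
rewrite [X in _ <= X + _](eq_bigl (fun i : 'I_q.+1 => i < k)%N) => [|i]; last first.
  by rewrite andb_idl// => /leq_trans; apply.
by rewrite lerDl sumr_ge0// => i _; exact: ltW.
Qed.

Lemma state_itvE s x : state_itv s x = (s.2 <= x < s.2 + m s.1) :> Prop.
Proof. by rewrite /state_itv /= in_itv. Qed.

Lemma state_itv_child s :
  state_itv s = \bigcup_(j in [set: 'I_q.+1]) state_itv (child s j).
Proof.
have cut0 : cut s 0 = s.2 by rewrite /cut big_pred0 ?addr0.
have cutq : cut s q.+1 = s.2 + m s.1.
  by rewrite /cut -mS; congr (_ + _); apply: eq_bigl => i; rewrite ltn_ord.
apply/seteqP; split => x; last first.
  move=> [j _]; rewrite !state_itvE -cutS => /andP[h1 h2].
  rewrite -cutq -cut0 (le_trans _ h1) ?cut_le//.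
  by rewrite (lt_le_trans h2)// cut_le.
rewrite state_itvE -cutq => /andP[h1].
have : (q.+1 <= q.+1)%N by [].
elim: {1 3}q.+1 => [|k ih] kq; first by rewrite cut0 ltNge h1.
have [/(ih (ltnW kq))//|ckx h2] := ltP x (cut s k).
by exists (Ordinal kq) => //; rewrite state_itvE/= ckx -(cutS s (Ordinal kq)).
Qed.

Lemma trivIset_child s : trivIset [set: 'I_q.+1] (fun j => state_itv (child s j)).
Proof.
apply/trivIsetP => i j _ _.
wlog ij : i j / (i < j)%N => [hw ij|_].
  have := ij; rewrite -(inj_eq val_inj) neq_ltn => /orP[]/hw; first exact.
  by rewrite setIC eq_sym; exact.
apply/seteqP; split => x //=; rewrite -[X in X /\ _]/(state_itv _ x).
rewrite -[X in _ /\ X]/(state_itv _ x) !state_itvE /= -cutS.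
move=> -[/andP[_ x1] /andP[x2 _]].
by have := lt_le_trans x1 (cut_le s ij); rewrite ltNge x2.
Qed.

Lemma step_child s j x : state_itv (child s j) x -> step x s = child s j.
Proof.
move=> jx; rewrite /step; case: pickP => [i|/(_ j)]; last by rewrite mem_set.
rewrite inE => ix; congr child; apply/eqP/negPn/negP => ij.
have /trivIsetP := @trivIset_child s.
by move=> /(_ i j I I ij)/seteqP[/(_ x) + _]; apply.
Qed.

Local Notation mu := (@lebesgue_measure R).

Lemma measure_state_itv s : mu (state_itv s) = (m s.1)%:E.
Proof.
rewrite /state_itv lebesgue_measure_itv/= lte_fin ltrDl m_gt0 -EFinD; congr _%:E.
by rewrite addrAC subrr add0r.
Qed.

Lemma measurable_state_itv s : measurable (state_itv s).
Proof. exact: measurable_itv. Qed.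

(** [phi a] is the mean of [Phi] over the interval of any state with counts [a].
    Since the state is not fixed, the property survives a step, where the interval
    is replaced by those of its children. *)
Definition mean_on (Phi : state -> R -> R)
    (phi : {ffun 'I_q.+1 -> nat} -> R) : Prop :=
  forall s, [/\ measurable_fun (state_itv s) (Phi s), forall x, 0 <= Phi s x &
    (\int[mu]_(x in state_itv s) (Phi s x)%:E = (m s.1 * phi s.1)%:E)%E].

Lemma mean_on_const (f : {ffun 'I_q.+1 -> nat} -> R) : (forall a, 0 <= f a) ->
  mean_on (fun s _ => f s.1) f.
Proof.
move=> f0 s; split=> //.
rewrite integral_cst; last exact: measurable_state_itv.
by rewrite [X in (_ * X)%E](measure_state_itv s) -EFinM mulrC.
Qed.

Lemma mean_on_step Phi phi : mean_on Phi phi ->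
  mean_on (fun s x => Phi (step x s) x) (draw phi).
Proof.
move=> P s.
have stepE j :
    {in state_itv (child s j), Phi (child s j) =1 (fun x => Phi (step x s) x)}.
  by move=> x; rewrite inE => /step_child ->.
have mP j : measurable_fun (state_itv (child s j)) (fun x => Phi (step x s) x).
  apply: (@eq_measurable_fun _ _ _ _ _ (Phi (child s j)) _ (stepE j)).
  by case: (P (child s j)).
have mS' : measurable_fun (state_itv s) (fun x => Phi (step x s) x).
  rewrite state_itv_child => mU Y mY; rewrite setI_bigcupl.
  apply: fin_bigcup_measurable => // j _; apply: mP => //.
  exact: measurable_state_itv.
split=> // [x|]; first by case: (P (step x s)).
have su : state_itv s = \big[setU/set0]_(j <- index_enum 'I_q.+1) state_itv (child s j).
  rewrite state_itv_child -bigcup_seq; congr bigcup.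
  by apply/seteqP; split => j //= _; rewrite mem_index_enum.
rewrite su ge0_integral_bigsetU//=.
- rewrite /draw mulr_sumr -sumEFin; apply: eq_bigr => j _.
  transitivity (\int[mu]_(x in state_itv (child s j)) (Phi (child s j) x)%:E)%E.
    by apply: eq_integral => x jx; rewrite (stepE j x jx).
  have [_ _ ->] := P (child s j).
  by rewrite mulrA mulrCA mulfV ?mulr1// gt_eqF.
- by move=> j; exact: measurable_state_itv.
- exact: index_enum_uniq.
- exact: sub_trivIset (@trivIset_child s).
- by rewrite -su; exact/measurable_EFinP.
- by move=> x _; rewrite lee_fin; case: (P (step x s)).
Qed.

Lemma mean_on_iter n Phi phi : mean_on Phi phi ->
  mean_on (fun s x => Phi (iter n (step x) s) x) (iter n draw phi).
Proof.
move=> P; elim: n => //= n /mean_on_step.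
by congr mean_on; apply/funext => s; apply/funext => x; rewrite -iterSr.
Qed.

(** The value outside [[0, 1[], a null set for the uniform law on [[0, 1]], is
    chosen to make the functions of the counts measurable on the whole line. *)
Definition contents n (x : R) : {ffun 'I_q.+1 -> nat} :=
  if x \in `[0, 1[ then (iter n (step x) (0, 0)).1 else 0.

Hypothesis m0 : m 0 = 1.

(** The counts [N n] as random variables on one probability space, specified by
    the joint laws of pairs, which give the variances of all increments. *)
Lemma urn_contents_exist : exists (d : measure_display) (T : measurableType d)
    (P : probability T R) (N : nat -> T -> {ffun 'I_q.+1 -> nat}),
  forall n k (g : {ffun 'I_q.+1 -> nat} -> {ffun 'I_q.+1 -> nat} -> R),
  (forall a b, 0 <= g a b) ->
  measurable_fun setT (fun x => g (N n x) (N (n + k)%N x)) /\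
  (\int[P]_x (g (N n x) (N (n + k)%N x))%:E =
   (after n (fun a => iter k draw (g a) a))%:E)%E.
Proof.
exists _, _, (uniform_prob (@ltr01 R)), contents => n k g g0.
have H : mean_on (fun s x => g s.1 (iter k (step x) s).1)
    (fun a => iter k draw (g a) a).
  by move=> s; have := mean_on_iter k (mean_on_const (g0 s.1)); apply.
have [mH _ intH] := mean_on_iter n H (0, 0).
have s01 : state_itv (0, 0) = `[0, 1[%classic by rewrite /state_itv /= m0 add0r.
have E : {in state_itv (0, 0), (fun x => g (iter n (step x) (0, 0)).1
    (iter k (step x) (iter n (step x) (0, 0))).1) =1
    (fun x => g (contents n x) (contents (n + k) x))}.
  move=> x; rewrite s01 inE/= => x01; rewrite /contents x01.
  by rewrite addnC iterD.
have m01 : measurable_fun setT (fun x => g (contents n x) (contents (n + k) x)).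
  have ms := measurable_state_itv (0, 0).
  rewrite -(setUv (state_itv (0, 0))); apply/(measurable_funU _ ms (measurableC ms)).
  split; first by apply: eq_measurable_fun mH; exact: E.
  apply: (@eq_measurable_fun _ _ _ _ _ (cst (g 0 0))); last exact: measurable_cst.
  by move=> x; rewrite s01 inE/= => /negP x01; rewrite /contents (negbTE x01).
split=> //; rewrite integral_uniform//; last first.
- by move=> x; rewrite lee_fin.
- exact/measurable_EFinP.
rewrite subr0 invr1 mul1e /after.
move: intH; rewrite m0 mul1r => <-.
rewrite s01; rewrite -integral_itv_bndo_bndc; last first.
  exact/measurable_EFinP/measurable_funTS.
by apply: eq_integral => x; rewrite -s01 => /E <-.
Qed.

(** The second moments increase to a limit, so [t k] need only be so large that all
    of them are close enough to it. *)
Lemma fast_subsequence : exists2 t : nat -> nat, (forall k, (k <= t k <= t k.+1)%N) &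
  forall k j, second_moment (cbasis j) (t k.+1) - second_moment (cbasis j) (t k)
    <= (1 / (2 ^ (k + 1))%:R) ^+ 2.
Proof.
pose V j := second_moment (cbasis j); pose e k : R := (1 / (2 ^ (k + 1))%:R) ^+ 2.
have Vle j n : V j n <= limn (V j).
  apply: nondecreasing_cvgn_le; first exact: second_moment_nondecreasing.
  exact: is_cvg_second_moment.
have /choice[K KP] k : exists K, forall n j, (K <= n)%N -> limn (V j) - e k <= V j n.
  have ek : 0 < e k by rewrite exprn_gt0// divr_gt0// ltr0n expn_gt0.
  have : \forall n \near \oo, forall j, limn (V j) - e k <= V j n.
    apply: filter_forall => j; have := @is_cvg_second_moment (cbasis j).
    move=> /cvgrPdist_le/(_ _ ek); apply: filterS => n.
    rewrite lerBlDr -lerBlDl; apply: le_trans; exact: ler_norm.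
  by move=> [K _ KP]; exists K => n j Kn; exact: KP.
(* Summing the bounds makes [t] increasing while [K k <= t k]. *)
pose t k := (\sum_(i < k.+1) (K i).+1)%N.
have tS k : t k.+1 = (t k + (K k.+1).+1)%N by rewrite /t big_ord_recr.
exists t => [k|k j].
  rewrite tS leq_addr andbT; elim: k => // k ih; rewrite tS.
  by rewrite -[k.+1]addn1 leq_add.
rewrite (le_trans (lerB (Vle j _) (KP k (t k) j _)))//.
  by rewrite /t big_ord_recr/= (leq_trans (leqnSn (K k)))// leq_addl.
by rewrite opprB addrCA subrr addr0.
Qed.

(** The measure is the law of the limiting probabilities of the colours. Bounded
    convergence along the subsequence turns [cvg_after_prod] into the value of its
    moments. *)
Lemma moment_measure_exists :
  exists nu : probability (borel_simplex R q) R, forall b, cmoment nu b = m b.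
Proof.
have [t tP tV] := fast_subsequence.
have [d [T [P [N meanN]]]] := urn_contents_exist.
pose p j k x : R := block_prob (cbasis j) (N (t k) x).
have mp j k : measurable_fun setT (p j k).
  have [+ _] := meanN (t k) 0 (fun a _ => block_prob (cbasis j) a)
    (fun a _ => block_prob_ge0 _ a).
  exact.
have p01 j k x : 0 <= p j k x <= 1 by rewrite block_prob_ge0 block_prob_le1.
have cvg_p j : {ae P, forall x, cvgn (p j ^~ x)}.
  apply: ae_cvg_summable_increments => [k|k]; first exact: mp.
  have /andP[_ /subnKC tk] := tP k.
  have [_] := meanN (t k) (t k.+1 - t k)%N
    (fun a a' => `|block_prob (cbasis j) a' - block_prob (cbasis j) a|)
    (fun a b => normr_ge0 _).
  rewrite tk => ->; rewrite lee_fin.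
  set e := 1 / _; have e0 : 0 < e by rewrite /e divr_gt0// ltr0n expn_gt0.
  apply: (le_trans (after_norm_increment _ _ _ e0)); rewrite tk.
  by rewrite ler_pdivrMr// mulr_natr mulr2n lerD2l ler_pdivrMr// -expr2 tV.
(* The upper limit is measurable everywhere, and almost surely a limit. *)
pose V j x : R := limn_sup (p j ^~ x).
have mV j : measurable_fun setT (V j).
  apply: measurable_fun_limn_sup => // x _.
    by exists 1 => _ [k _ <-]; case/andP: (p01 j k x).
  by exists 0 => _ [k _ <-]; case/andP: (p01 j k x).
have cvgV : {ae P, forall x, forall j, p j k x @[k --> \oo] --> V j x}.
  suff : {ae P, forall x, forall j, cvgn (p j ^~ x)}.
    by apply: filterS => x cx j; rewrite /V (cvg_limn_supE (cx j)); exact: cx.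
  exact: filter_forall cvg_p.
(* Where the limit does not exist, [V] may leave the simplex. *)
pose vertex : {u | u \in simplex R q.+1} :=
  exist (fun u => u \in simplex R q.+1) _ (simplex_vertex R q).
pose U x : borel_simplex R q := insubd vertex (\row_j V j x).
have simpV x : (forall j, p j k x @[k --> \oo] --> V j x) ->
    simplex R q.+1 (\row_j V j x).
  move=> cx; split=> [j|].
    rewrite mxE; apply/andP; split.
      by apply: (cvgr_to_ge (cx j)); apply: nearW => k; case/andP: (p01 j k x).
    by apply: (cvgr_to_le (cx j)); apply: nearW => k; case/andP: (p01 j k x).
  under eq_bigr do rewrite mxE.
  have : \sum_j p j k x @[k --> \oo] --> \sum_j V j x.
    by apply: cvg_big => [|j _]; [exact: add_continuous|exact: cx].
  rewrite (_ : (fun k => _) = cst 1) => [/cvg_lim <-//|]; first exact: lim_cst.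
  by apply/funext => k; exact: sum_draw_prob.
have coordU x j : simplex R q.+1 (\row_j V j x) -> coord (U x) j = V j x.
  by move=> sx; rewrite /coord /U /set_val/= val_insubd mem_set// mxE.
pose S := [set x | simplex R q.+1 (\row_j V j x)].
have mSV : measurable S.
  rewrite (_ : S = (\bigcap_(j in [set: 'I_q.+1]) V j @^-1` `[0, 1]) `&`
      (fun x => \sum_j V j x) @^-1` [set 1]); last first.
    rewrite /S /simplex; apply/seteqP; split => x /= [].
      move=> V01; under eq_bigr do rewrite mxE.
      by split => // j _ /=; have := V01 j; rewrite mxE in_itv.
    move=> V01; under [in X in _ -> X]eq_bigr do rewrite mxE.
    by split => // j; have := V01 j I; rewrite mxE /= in_itv.
  apply: measurableI.
    apply: fin_bigcap_measurable => // j _.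
    by rewrite -[X in measurable X]setTI; exact: mV.
  rewrite -[X in measurable X]setTI.
  by have := @measurable_sum _ _ _ setT _ (index_enum 'I_q.+1) V mV; apply.
have mU : measurable_fun setT U.
  apply: measurable_simplex => j.
  rewrite (_ : (fun x => _) = (fun x => V j x * \1_S x +
      coord (vertex : borel_simplex R q) j * \1_(~` S) x)).
    apply: measurable_funD; apply: measurable_funM => //.
    by apply: measurable_indic; exact: measurableC.
  apply/funext => x; rewrite !indicE in_setC.
  have [xS|xS] := boolP (x \in S).
    by rewrite mulr1 mulr0 addr0 coordU//; move: xS; rewrite inE.
  by rewrite mulr0 mulr1 add0r /U /insubd insubN.
pose Um := mfun_Sub (mem_set mU : U \in mfun).
exists (distribution P Um) => b.
rewrite /cmoment /Rintegral.
rewrite (ge0_integral_distribution _ (f := fun u => (monomial b u)%:E)); last 2 first.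
- by apply/measurable_EFinP; exact: measurable_monomial.
- by move=> u; rewrite lee_fin; case/andP: (monomial_itv b u).
suff -> : (\int[P]_x (monomial b (U x))%:E)%E = (m b)%:E by [].
have cvg1 : (\int[P]_x (\prod_j p j k x ^+ b j)%:E @[k --> \oo] -->
    \int[P]_x (monomial b (U x))%:E)%E.
  apply: bounded_convergence.
  - move=> k; apply: measurable_prod => j _.
    by apply: (measurableT_comp (exprn_measurable (b j))); exact: mp.
  - exact: (measurableT_comp (@measurable_monomial R q b) mU).
  - move=> k x; rewrite ger0_norm.
      apply: prodr_ile1 => j _; have /andP[p0 p1] := p01 j k x.
      by rewrite exprn_ge0//= exprn_ile1.
    by apply: prodr_ge0 => j _; rewrite exprn_ge0//; case/andP: (p01 j k x).
  - apply: filterS cvgV => x cx.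
    have -> : monomial b (U x) = \prod_j V j x ^+ b j.
      by apply: eq_bigr => j _; rewrite coordU//; exact: simpV.
    apply: cvg_big => [|j _]; first exact: mul_continuous.
    apply: (@continuous_cvg _ _ _ _ _ _ (@GRing.exp R ^~ (b j))) (cx j).
    exact: exprn_continuous.
have cvg2 : (\int[P]_x (\prod_j p j k x ^+ b j)%:E @[k --> \oo] --> (m b)%:E)%E.
  pose F a : R := \prod_j block_prob (cbasis j) a ^+ b j.
  have F0 a : 0 <= F a by apply: prodr_ge0 => j _; rewrite exprn_ge0 ?block_prob_ge0.
  have EF k : (\int[P]_x (\prod_j p j k x ^+ b j)%:E = (after (t k) F)%:E)%E.
    by have [_] := meanN (t k) 0 (fun a _ => F a) (fun a _ => F0 a).
  under eq_fun do rewrite EF; apply: cvg_EFin; first exact: nearW.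
  have cF : after n F @[n --> \oo] --> m b.
    have := @cvg_after_prod b 0; rewrite m0 divr1 addr0.
    rewrite (_ : (fun a => _ * block_prob 0 a) = F)//.
    by apply/funext => a; rewrite block_prob0 mulr1.
  have t_oo : t k @[k --> \oo] --> \oo.
    apply/cvgnyPge => n; near=> k; have /andP[kt _] := tP k; apply: leq_trans kt.
    by near: k; exact: nbhs_infty_ge.
  exact: cvg_comp t_oo cF.
exact: (cvg_unique _ cvg1 cvg2).
Unshelve. all: by end_near. Qed.

End urn.

(** * Adding and removing one unit in a multiset of blocks *)

Section multisets_of_blocks.
Local Open Scope mset_scope.
Variable q : nat.
Implicit Types (A B : {mset cvec q}) (a b : cvec q).

Lemma cweightD A B : cweight (A `+` B) = (cweight A + cweight B)%N.
Proof.
have widen C : (finsupp C `<=` finsupp A `|` finsupp B)%fset ->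
    cweight C = (\sum_(a <- (finsupp A `|` finsupp B)%fset) C a * csize a)%N.
  move=> CAB; rewrite /cweight; apply: big_fset_incl => // a _.
  by rewrite memNfinsupp => /eqP ->.
rewrite !widen ?fsubsetUl ?fsubsetUr//; last first.
  by apply/fsubsetP => a; rewrite inE !msuppE in_msetD.
by rewrite -big_split; apply: eq_bigr => a _; rewrite msetE2 mulnDl.
Qed.

Lemma cweight_msetn n a : cweight (msetn n a) = (n * csize a)%N.
Proof.
rewrite /cweight finsupp_msetn; case: n => [|n] /=.
  by rewrite big_seq_fset0 mul0n.
by rewrite big_seq_fset1 msetnxx.
Qed.

Lemma cweight1 a : cweight [mset a] = csize a.
Proof. by rewrite cweight_msetn mul1n. Qed.

Lemma cweight0_eq A : cweight A = 0%N -> A = mset0.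
Proof.
move=> A0; apply/msetP => a; rewrite mset0E; apply/eqP.
have := cweight_ge A a; rewrite A0 leqn0 muln_eq0 => /orP[//|].
by rewrite eqn0Ngt cvec_csize_gt0.
Qed.

Lemma cweightB1 A a : a \in A -> cweight (A `\ a) = (cweight A - csize a)%N.
Proof.
by move=> aA; rewrite -{2}(msetB1K aA) cweightD cweight1 addKn.
Qed.

Lemma csize_le_cweight A a : a \in A -> (csize a <= cweight A)%N.
Proof.
by move=> aA; rewrite -(msetB1K aA) cweightD cweight1 leq_addr.
Qed.

(** The block that receives a new unit is encoded by an option, [None] standing
    for a block not yet present, whose counts are [0]. *)
Definition content (o : option (cvec q)) : {ffun 'I_q -> nat} :=
  if o is Some b then cvec_val b else 0.

Definition others B (o : option (cvec q)) : {mset cvec q} :=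
  if o is Some b then B `\ b else B.

Definition add_unit B o j : {mset cvec q} :=
  grow (content o) j +` others B o.

Definition sites B : seq (option (cvec q)) :=
  None :: map Some (finsupp B).

Lemma sitesP B b : (Some b \in sites B) = (b \in B).
Proof. by rewrite inE /= mem_map ?msuppE// => x y []. Qed.

Lemma content_inj : injective content.
Proof.
move=> [a|] [b|] //= ab.
- by congr Some; exact: val_inj.
- by have := valP a; rewrite /= -[val a]/(cvec_val a) ab eqxx.
- by have := valP b; rewrite /= -[val b]/(cvec_val b) -ab eqxx.
Qed.

Lemma add_unitE B o j : o \in sites B ->
  add_unit B o j (grow (content o) j) = (B (grow (content o) j)).+1.
Proof.
rewrite /add_unit mset1DE eqxx add1n; case: o => //= b _.
rewrite msetB1E; case: eqP => [E|_]; last by rewrite subn0.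
have := csize_grow b j; rewrite E => /eqP.
by rewrite -[X in X == _]addn0 -addn1 eqn_add2l.
Qed.

Lemma cremove_add_unit B o j : o \in sites B ->
  cremove (add_unit B o j) (grow (content o) j) j = B.
Proof.
move=> oB; rewrite /cremove /add_unit. rewrite msetD1K /=; case: o oB => [b|] /=.
  rewrite sitesP => bB; rewrite ifN; last first.
    apply: contra (valP b) => /eqP/ffunP E; apply/eqP/ffunP => i.
    have /eqP := E i; rewrite !ffunE => /eqP.
    rewrite -[X in X = _]/((b i + _)%N) -[X in _ = X]add0n => /eqP.
    by rewrite eqn_add2r => /eqP.
  rewrite (_ : [ffun _ => _] = val b); last first.
    by apply/ffunP => i; rewrite !ffunE addnK.
  by rewrite valKd msetDC msetB1K.
by move=> _; rewrite add0r eqxx.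
Qed.

Lemma cremove_inv A B a j : a \in A -> (0 < a j)%N -> B = cremove A a j ->
  exists2 o, o \in sites B & A = add_unit B o j.
Proof.
move=> aA aj; rewrite /cremove; case: ifPn => [/eqP ae|ae] BE.
  exists None; first by rewrite inE.
  rewrite /add_unit /= BE -[LHS](msetB1K aA); congr (_ `+` _).
  by congr msetn; apply: val_inj; rewrite /= add0r.
set a' := insubd a _ in BE; exists (Some a').
  by rewrite sitesP BE in_msetD in_mset1 eqxx orbT.
rewrite /add_unit /= BE (msetDC (A `\ a)) msetD1K -[LHS](msetB1K aA).
congr (_ `+` _); congr msetn; apply: val_inj; rewrite /= cremove_val//.
apply/ffunP => i; rewrite !ffunE -[RHS]/((_ - _ + _)%N) subnK//.
by case: eqP => // ->.
Qed.

Lemma cweight_add_unit B o j : o \in sites B ->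
  cweight (add_unit B o j) = (cweight B).+1.
Proof.
rewrite /add_unit cweightD cweight1 csize_grow; case: o => [b|_].
  by rewrite sitesP => bB; rewrite /= -[in RHS](msetB1K bB) cweightD cweight1.
by rewrite /= csize0.
Qed.

(** Transitions to [B] come from the multisets [add_unit B x j] only, and these are
    distinct, since [cremove_inj] recovers the block and the colour. *)
Lemma sum_ctrans (R : realType) n (F : {mset cvec q} -> R) B : cweight B = n ->
  \sum_(A \in cpart q n.+1) F A * ctrans R n.+1 A B =
  \sum_(o <- sites B) \sum_(j < q) F (add_unit B o j) *
     ((content o j).+1 * (B (grow (content o) j)).+1)%:R / n.+1%:R.
Proof.
move=> Bn; pose L := [seq add_unit B o j | o <- sites B, j <- index_enum 'I_q].
have uL : uniq L.
  apply: allpairs_uniq; rewrite ?index_enum_uniq//.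
    rewrite /sites /= map_inj_uniq ?fset_uniq; last by move=> x y [].
    by rewrite andbT; apply/mapP => -[].
  move=> p p' /allpairsPdep[x1 [j1 [xB _ ->]]].
  move=> /allpairsPdep[x2 [j2 [xB' _ ->]]] /= E.
  have g1 : grow (content x1) j1 \in add_unit B x1 j1 by exact: mset1D1.
  have g2 : grow (content x2) j2 \in add_unit B x1 j1 by rewrite E; exact: mset1D1.
  have gp x j : (0 < grow (content x) j j)%N by rewrite grow_same.
  have [|gg jj] := cremove_inj g1 g2 (gp _ _) (gp _ _).
    by rewrite {2}E !cremove_add_unit.
  congr pair => //; apply: content_inj; apply/ffunP => i.
  have /(congr1 (@cvec_val q))/ffunP/(_ i) := gg; rewrite !ffunE -jj.
  exact: addIn.
transitivity (\sum_(A \in [set` L]) F A * ctrans R n.+1 A B).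
  apply/esym/fsbig_widen.
    move=> A /= /allpairsPdep[x [j [xB _ ->]]].
    by rewrite /cpart /= cweight_add_unit// Bn.
  move=> A /= [_ nA]; rewrite ctrans_eq0 ?mulr0// => a j aA aj BE.
  apply: nA => /=; have [x xB ->] := cremove_inv aA aj BE.
  by apply/allpairsPdep; exists x, j; rewrite mem_index_enum.
rewrite -fsbig_seq// big_allpairs_dep /= big_seq [RHS]big_seq.
apply: eq_bigr => o oB; apply: eq_bigr => j _.
have gA : grow (content o) j \in add_unit B o j by exact: mset1D1.
have := @ctrans_cremove R _ n.+1 _ _ j gA; rewrite grow_same => /(_ isT).
by rewrite cremove_add_unit// => ->; rewrite add_unitE// mulrA.
Qed.

Definition gibbs (R : realType) (w : cvec q -> R) A : R :=
  \prod_(a <- finsupp A) ((A a)`!%:R^-1 * w a ^+ A a).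

Lemma gibbs_remove (R : realType) (w : cvec q -> R) A r :
  r \in A -> (A r)%:R * gibbs w A = w r * gibbs w (A `\ r).
Proof.
move=> rA; rewrite /gibbs (@big_fset_incl _ _ _ _ (finsupp (A `\ r)) (finsupp A)).
- have rs : r \in (finsupp A : seq _) by rewrite msuppE.
  rewrite (big_rem r rs)/= [in RHS](big_rem r rs)/= !mulrA; congr (_ * _); last first.
    apply: eq_big_seq => a; rewrite mem_rem_uniq ?fset_uniq// inE.
    move=> /andP[/negbTE ar _].
    by rewrite msetB1E ar subn0.
  rewrite msetB1E eqxx; have : (0 < A r)%N by rewrite mset_gt0.
  case: (A r) => // n _; rewrite subn1 /= factS natrM exprS.
  by field; rewrite nat1r !pnatr_eq0 -lt0n fact_gt0.
- by apply/fsubsetP => a; rewrite !msuppE in_msetB1 => /andP[].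
- by move=> a _; rewrite memNfinsupp => /eqP ->; rewrite fact0 invr1 mul1r.
Qed.

End multisets_of_blocks.

(** * Partition structures with factorizing removal rates *)

Section factorizing_structure.
Local Open Scope mset_scope.
Variables (R : realType) (q : nat) (P : nat -> {mset cvec q.+1} -> R).
Hypothesis Pstruct : cpart_structure P.
Hypothesis Ppos : forall n A, (1 <= n)%N -> cpart q.+1 n A -> 0 < P n A.
Variable b : nat -> cvec q.+1 -> R.
Hypothesis Pfactor : forall n A r, (1 <= n)%N -> cpart q.+1 n A ->
  ([mset r] `<=` A)%mset ->
  (csize r)%:R * (A r)%:R * P n A = b n r * P (n - csize r)%N (A `\ r).
Implicit Types (A B : {mset cvec q.+1}) (r s : cvec q.+1).

Let unit_block : cvec q.+1 := grow 0 ord0.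

Lemma csize_unit_block : csize unit_block = 1%N.
Proof. exact: csize_grow0. Qed.

Lemma mass_mset0 : P 0 mset0 = 1.
Proof.
have [_ /(_ 0%N) + _] := Pstruct; rewrite (_ : cpart _ _ = [set mset0]).
  by rewrite fsbig_set1.
apply/seteqP; split => A /=; first exact: cweight0_eq.
by move=> ->; rewrite /cpart /= /cweight finsupp0 big_seq_fset0.
Qed.

Lemma mass_gt0 A : 0 < P (cweight A) A.
Proof.
have [A0|A0] := posnP (cweight A); last exact: Ppos.
by rewrite A0 (cweight0_eq A0) mass_mset0.
Qed.

Lemma mass_remove A r : r \in A -> (csize r)%:R * (A r)%:R * P (cweight A) A =
  b (cweight A) r * P (cweight (A `\ r)) (A `\ r).
Proof.
move=> rA; rewrite cweightB1//; apply: Pfactor => //.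
  by rewrite (leq_trans _ (csize_le_cweight rA))// cvec_csize_gt0.
apply/forallP => -[x xr] /=; rewrite msuppE in_mset1 in xr.
by rewrite (eqP xr) msetnxx mset_gt0.
Qed.

(** Multisets of a large prescribed weight that contain given blocks. *)
Definition pad k A : {mset cvec q.+1} := A `+` msetn k unit_block.
Arguments pad k%_N A.

Lemma cweight_pad k A : cweight (pad k A) = (cweight A + k)%N.
Proof. by rewrite cweightD cweight_msetn csize_unit_block muln1. Qed.

Lemma rate_gt0 n r : (csize r <= n)%N -> 0 < b n r.
Proof.
move=> rn; pose A := pad (n - csize r) [mset r].
have rA : r \in A by rewrite in_msetD in_mset1 eqxx.
have An : cweight A = n by rewrite cweight_pad cweight1 subnKC.
have := mass_remove rA; rewrite An => E.
rewrite -(pmulr_lgt0 _ (mass_gt0 (A `\ r))) -E -An.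
by rewrite !mulr_gt0 ?mass_gt0// ltr0n ?mset_gt0// cvec_csize_gt0.
Qed.

(** Both orders of removal of [r] and [s] end in the same multiset, and its mass
    is positive. *)
Lemma rate_comm n r s : (csize r + csize s <= n)%N ->
  b n r * b (n - csize r) s = b n s * b (n - csize s) r.
Proof.
have [->//|rs rsn] := eqVneq r s.
pose A := pad (n - (csize r + csize s)) ([mset r] `+` [mset s]).
have An : cweight A = n by rewrite cweight_pad cweightD !cweight1 subnKC.
have rA : r \in A by rewrite !in_msetD !in_mset1 eqxx.
have sA : s \in A by rewrite !in_msetD !in_mset1 eqxx orbT.
have E r' s' : r' != s' -> r' \in A -> s' \in A ->
    (csize r')%:R * (A r')%:R * ((csize s')%:R * (A s')%:R) * P n A =
    b n r' * b (n - csize r') s' * P (cweight (A `\ r' `\ s')) (A `\ r' `\ s').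
  move=> rs' rA' sA'.
  have sAr : s' \in A `\ r' by rewrite in_msetB1 eq_sym (negbTE rs').
  have := mass_remove sAr; rewrite msetB1E eq_sym (negbTE rs') subn0.
  rewrite [in X in _ = X -> _]cweightB1// An => E2.
  have := mass_remove rA'; rewrite An => E1.
  have -> : (csize r')%:R * (A r')%:R * ((csize s')%:R * (A s')%:R) * P n A =
      (csize s')%:R * (A s')%:R * ((csize r')%:R * (A r')%:R * P n A) by ring.
  by rewrite E1 mulrCA E2 mulrA.
have := E _ _ rs rA sA; rewrite [X in X * P n A]mulrC.
have -> : A `\ r `\ s = A `\ s `\ r.
  by apply/msetP => x; rewrite !msetB1E subnAC.
by rewrite E// 1?eq_sym// => /(mulIf (lt0r_neq0 (mass_gt0 _))).
Qed.

Definition unit_rate n : R := \sum_j b n (grow 0 j).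
Definition rate_prod n : R := \prod_(i < n) unit_rate i.+1.
Definition block_weight r : R := b (csize r) r / rate_prod (csize r).

Lemma unit_rate_gt0 n : 0 < unit_rate n.+1.
Proof.
rewrite /unit_rate (bigD1 ord0)//= ltr_wpDr//.
  by apply: sumr_ge0 => j _; apply/ltW/rate_gt0; rewrite csize_grow0.
by apply: rate_gt0; rewrite csize_unit_block.
Qed.

Lemma rate_prod_gt0 n : 0 < rate_prod n.
Proof. by apply: prodr_gt0 => i _; exact: unit_rate_gt0. Qed.

Lemma block_weight_gt0 r : 0 < block_weight r.
Proof. by rewrite divr_gt0 ?rate_prod_gt0// rate_gt0. Qed.

(** [rate_comm] summed over the blocks [s] of one unit expresses [b n r] by
    [b n.-1 r]; the ratios of unit rates telescope. *)
Lemma rateE k r :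
  b (k + csize r)%N r = block_weight r * rate_prod (k + csize r) / rate_prod k.
Proof.
elim: k => [|k ih].
  rewrite add0n /block_weight {3}/rate_prod big_ord0 divr1 mulfVK//.
  by rewrite gt_eqF// rate_prod_gt0.
have comm : b (k.+1 + csize r) r * unit_rate k.+1 =
    unit_rate (k.+1 + csize r) * b (k + csize r) r.
  rewrite /unit_rate mulr_sumr mulr_suml; apply: eq_bigr => j _.
  have := @rate_comm (k.+1 + csize r) r (grow 0 j).
  by rewrite csize_grow0 addnK addSn subn1 /=; apply; rewrite addn1 ltnS leq_addl.
apply: (mulIf (lt0r_neq0 (unit_rate_gt0 k))); rewrite comm ih.
rewrite addSn /rate_prod !big_ord_recr/=.
by field; rewrite !gt_eqF ?unit_rate_gt0 ?rate_prod_gt0.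
Qed.

(** The contribution of a block [r] to [consistency]. *)
Definition growth r : R := (csize r)%:R / (csize r).+1%:R *
  (\sum_j (r j).+1%:R * block_weight (grow r j)) / block_weight r.

(** The consistency relation at [B], divided by [P B]. In a multiset obtained by
    adding a unit to a block [r] of [B], the mass is compared with that of [B] by
    removing the enlarged block from the one and [r] from the other; by [rateE] the
    ratio depends on [r] and on the weight of [B] only. *)
Lemma consistency B : (cweight B).+1%:R =
  unit_rate (cweight B).+1 * (1 + \sum_(r <- finsupp B) (B r)%:R * growth r).
Proof.
have [_ _ /(_ (cweight B) B erefl)] := Pstruct.
rewrite (sum_ctrans _ erefl); set n := cweight B => PB.
have P0 := mass_gt0 B.
apply: (mulIf (lt0r_neq0 P0)); rewrite -/n [LHS]mulrC {1}PB mulr_suml.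
under eq_bigr do rewrite mulr_suml.
have term x j : x \in sites B ->
    P n.+1 (add_unit B x j) * ((content x j).+1 *
      (B (grow (content x) j)).+1)%:R / n.+1%:R * n.+1%:R =
    (content x j).+1%:R / (csize (content x)).+1%:R * (b n.+1 (grow (content x) j)
     * P (cweight (others B x)) (others B x)).
  move=> xB; rewrite mulfVK ?pnatr_eq0//.
  have gA : grow (content x) j \in add_unit B x j by exact: mset1D1.
  have := mass_remove gA.
  rewrite cweight_add_unit// msetD1K add_unitE// csize_grow => <-.
  by rewrite natrM; field; rewrite nat1r pnatr_eq0.
rewrite big_seq; under eq_bigr => x xB do under eq_bigr => j _ do rewrite term//.
rewrite -big_seq /sites big_cons big_map mulrDr mulr1 mulrDl; congr (_ + _).
  rewrite /unit_rate mulr_suml; apply: eq_bigr => j _ /=.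
  by rewrite ffunE csize0 divr1 mul1r.
rewrite mulr_sumr mulr_suml big_seq [RHS]big_seq; apply: eq_bigr => r.
rewrite msuppE => rB /=.
have r0 : (csize r)%:R != 0 :> R by rewrite pnatr_eq0 -lt0n cvec_csize_gt0.
have [k nk] : exists k, n = (k + csize r)%N.
  by exists (n - csize r)%N; rewrite subnK// csize_le_cweight.
have PBr : P (cweight (B `\ r)) (B `\ r) = (csize r)%:R * (B r)%:R * P n B / b n r.
  rewrite (mass_remove rB) mulrAC mulfV ?mul1r// gt_eqF// rate_gt0//.
  exact: csize_le_cweight.
have -> : unit_rate n.+1 * ((B r)%:R * growth r) * P n B =
    unit_rate n.+1 * (B r)%:R * P n B * ((csize r)%:R / (csize r).+1%:R) /
    block_weight r *
    \sum_j (r j).+1%:R * block_weight (grow r j) by rewrite /growth; ring.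
rewrite PBr mulr_sumr; apply: eq_bigr => j _.
have -> : b n.+1 (grow r j) = block_weight (grow r j) * rate_prod n.+1 / rate_prod k.
  by rewrite nk -addnS -(csize_grow r j) rateE csize_grow addnS.
rewrite nk rateE -nk {1}/rate_prod big_ord_recr/= -/(rate_prod n).
by field; rewrite nat1r !gt_eqF ?rate_prod_gt0 ?block_weight_gt0 ?ltr0n.
Qed.

Definition ewens_theta : R := (growth unit_block)^-1.

Lemma ewens_theta_gt0 : 0 < ewens_theta.
Proof.
rewrite invr_gt0 /growth csize_unit_block divr_gt0 ?block_weight_gt0// mulr_gt0//.
rewrite (bigD1 ord0)//= ltr_wpDr//.
  by apply: sumr_ge0 => j _; rewrite mulr_ge0// ltW// block_weight_gt0.
by rewrite mulr_gt0 ?block_weight_gt0// ltr0n.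
Qed.

(** [consistency] at [n] blocks of one unit. *)
Lemma unit_rateE n : unit_rate n.+1 = ewens_theta * n.+1%:R / (ewens_theta + n%:R).
Proof.
have t0 := ewens_theta_gt0; have := consistency (msetn n unit_block).
rewrite cweight_msetn csize_unit_block muln1 finsupp_msetn => E.
have {E} : n.+1%:R = unit_rate n.+1 * (1 + n%:R * growth unit_block).
  rewrite E; congr (_ * (_ + _)); case: n {E} => [|n] /=.
    by rewrite big_seq_fset0 mul0r.
  by rewrite big_seq_fset1 msetnxx.
rewrite (_ : growth unit_block = ewens_theta^-1); last by rewrite invrK.
move=> E; have d0 : 0 < ewens_theta + n%:R by rewrite ltr_wpDr.
apply: (mulIf (lt0r_neq0 d0)); rewrite mulfVK ?gt_eqF// E.
by field; rewrite gt_eqF.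
Qed.

(** [consistency] takes the same value at one block [r] and at [csize r] blocks of
    one unit. *)
Lemma growthE r : growth r = (csize r)%:R / ewens_theta.
Proof.
have t0 := ewens_theta_gt0; have := consistency [mset r].
rewrite cweight1 finsupp_msetn big_seq_fset1 msetnxx mul1r unit_rateE => E.
have d0 : 0 < ewens_theta + (csize r)%:R by rewrite ltr_wpDr.
have n0 : (csize r).+1%:R != 0 :> R by rewrite pnatr_eq0.
have {E} : ewens_theta + (csize r)%:R = ewens_theta * (1 + growth r).
  apply: (mulfI n0); rewrite {1}E; field.
  by rewrite gt_eqF.
by rewrite mulrDr mulr1 => /addrI ->; rewrite mulrAC mulfV ?mul1r// gt_eqF.
Qed.

Lemma rate_prodE n : rate_prod n = ewens_theta ^+ n * n`!%:R / rising ewens_theta n.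
Proof.
have t0 := ewens_theta_gt0; elim: n => [|n ih].
  by rewrite /rate_prod /rising !big_ord0 mul1r divr1 fact0.
have d0 : 0 < ewens_theta + n%:R by rewrite ltr_wpDr.
rewrite /rate_prod big_ord_recr/= -/(rate_prod n) ih unit_rateE.
rewrite /rising big_ord_recr/= factS natrM exprS.
have r0 : 0 < \prod_(i < n) (ewens_theta + i%:R).
  by apply: prodr_gt0 => i _; rewrite ltr_wpDr.
by field; rewrite !gt_eqF.
Qed.

(** The moments for which the sampling formula gives the blocks the weights found
    in [rateE]. *)
Definition limit_moment (u : {ffun 'I_q.+1 -> nat}) : R :=
  if (insub u : option (cvec q.+1)) is Some r then
    ewens_theta ^+ csize r * block_weight r / (ewens_theta * cmultinom R u)
  else 1.

Lemma limit_momentE r : limit_moment r =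
  ewens_theta ^+ csize r * block_weight r / (ewens_theta * cmultinom R r).
Proof. by rewrite /limit_moment valK. Qed.

Lemma limit_moment0 : limit_moment 0 = 1.
Proof. by rewrite /limit_moment insubN// negbK. Qed.

Lemma limit_moment_gt0 u : 0 < limit_moment u.
Proof.
have t0 := ewens_theta_gt0; rewrite /limit_moment; case: insubP => [r _ _|_//].
by apply: divr_gt0; apply: mulr_gt0;
  rewrite ?exprn_gt0 ?block_weight_gt0 ?cmultinom_gt0.
Qed.

(** This is [growthE], the factors [(u j).+1] and [csize u] being absorbed by the
    multinomial coefficients. *)
Lemma sum_limit_moment u : \sum_j limit_moment (u + cbasis j) = limit_moment u.
Proof.
have t0 := ewens_theta_gt0.
have E j : limit_moment (u + cbasis j) =
    ewens_theta ^+ csize u * ((u j).+1%:R * block_weight (grow u j)) /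
    ((csize u).+1%:R * cmultinom R u).
  rewrite -[u + _]/(cvec_val (grow u j)) limit_momentE -(cmultinomS R u j).
  rewrite csize_grow exprS.
  by field; rewrite nat1r pnatr_eq0 !gt_eqF ?cmultinom_gt0.
under eq_bigr do rewrite E; rewrite -mulr_suml -mulr_sumr.
have [->|u0] := eqVneq u 0.
  rewrite csize0 cmultinom0 limit_moment0 !mul1r divr1.
  under eq_bigr do rewrite ffunE mul1r /block_weight csize_grow0.
  rewrite -mulr_suml -/(unit_rate 1) /rate_prod big_ord1 mulfV//.
  by rewrite gt_eqF// unit_rate_gt0.
pose r := Cvec u0; have := growthE r; rewrite /growth => G.
rewrite -[u]/(cvec_val r) limit_momentE.
have n0 : (csize r)%:R != 0 :> R by rewrite pnatr_eq0 -lt0n cvec_csize_gt0.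
have -> : \sum_j (r j).+1%:R * block_weight (grow r j) =
    (csize r).+1%:R * block_weight r / ewens_theta.
  have w0 : block_weight r != 0 by rewrite gt_eqF// block_weight_gt0.
  have S0 : (csize r).+1%:R != 0 :> R by rewrite pnatr_eq0.
  move: G; set S := \sum_j _ => G.
  have -> : S = (csize r).+1%:R * block_weight r / (csize r)%:R *
      ((csize r)%:R / (csize r).+1%:R * S / block_weight r).
    by field; rewrite nat1r S0 n0 w0.
  by rewrite G; field; rewrite n0 gt_eqF.
by field; rewrite nat1r pnatr_eq0 !gt_eqF ?cmultinom_gt0.
Qed.

(** The blocks are removed one after the other; the factors [rate_prod] in [rateE]
    telescope. *)
Lemma product_form A :
  P (cweight A) A =
  rate_prod (cweight A) * gibbs (fun r => block_weight r / (csize r)%:R) A.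
Proof.
have [n] := ubnP (cweight A); elim: n A => // n ih A An.
have [A0|] := posnP (cweight A).
  rewrite A0 (cweight0_eq A0) mass_mset0 /rate_prod big_ord0 mul1r.
  by rewrite /gibbs finsupp0 big_seq_fset0.
have [A0|[r]] := fset_0Vmem (finsupp A); first by rewrite /cweight A0 big_seq_fset0.
rewrite msuppE => rA _.
have rA' : 0 < (A r)%:R :> R by rewrite ltr0n mset_gt0.
have r0 : 0 < (csize r)%:R :> R by rewrite ltr0n cvec_csize_gt0.
have Ak : cweight A = (cweight (A `\ r) + csize r)%N.
  by rewrite cweightB1// subnK// csize_le_cweight.
apply: (mulfI (lt0r_neq0 (mulr_gt0 r0 rA'))); rewrite mass_remove// ih; last first.
  by rewrite -ltnS (leq_trans _ An)// ltnS Ak -addn1 leq_add2l cvec_csize_gt0.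
rewrite [RHS]mulrACA gibbs_remove// {1}Ak rateE -Ak.
by field; rewrite !gt_eqF ?rate_prod_gt0.
Qed.

Lemma factorizing_pESF (nu : probability (borel_simplex R q) R) A :
  (forall u, cmoment nu u = limit_moment u) ->
  P (cweight A) A = pESF ewens_theta nu (cweight A) A.
Proof.
move=> nuE; have t0 := ewens_theta_gt0.
rewrite product_form rate_prodE /pESF.
have -> : \prod_(a <- finsupp A) ((A a)`!%:R^-1 *
    (ewens_theta / (csize a)%:R * cmultinom R a * cmoment nu a) ^+ A a) =
    ewens_theta ^+ cweight A * gibbs (fun r => block_weight r / (csize r)%:R) A.
  rewrite /cweight -prodrXr -big_split; apply: eq_bigr => a _ /=.
  rewrite nuE limit_momentE [RHS]mulrCA mulnC exprM -exprMn; congr (_ * _ ^+ _).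
  have a0 : (csize a)%:R != 0 :> R by rewrite pnatr_eq0 -lt0n cvec_csize_gt0.
  by field; rewrite a0 !gt_eqF ?cmultinom_gt0.
by rewrite [RHS]mulrA; congr (_ * _); rewrite -mulrA mulrC.
Qed.

End factorizing_structure.

(** * Identification of the parameters *)

Section identification.
Local Open Scope mset_scope.
Variables (R : realType) (q : nat).
Implicit Types (nu : probability (borel_simplex R q) R) (t : R).

Lemma pESF_msetn t nu k (r : cvec q.+1) : (0 < k)%N ->
  pESF t nu (k * csize r)%N (msetn k r) =
  (k * csize r)`!%:R / rising t (k * csize r) *
  (k`!%:R^-1 * (t / (csize r)%:R * cmultinom R r * cmoment nu r) ^+ k).
Proof. by move=> k0; rewrite /pESF finsupp_msetn k0 big_seq_fset1 msetnxx. Qed.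

Lemma rising_gt0 t n : 0 < t -> 0 < rising t n.
Proof. by move=> t0; apply: prodr_gt0 => i _; rewrite ltr_wpDr. Qed.

Lemma cmoment0 nu : cmoment nu 0 = 1.
Proof.
transitivity (\int[nu]_(u in setT) cst (1 : R) u).
  apply: eq_Rintegral => u _; rewrite big1// => j _.
  by rewrite ffunE.
by rewrite Rintegral_cst// mul1r [X in fine X]probability_setT.
Qed.

(** The mass of a one-block multiset is a moment up to a positive factor. *)
Lemma cmoment_inj t nu nu' : 0 < t ->
  (forall r : cvec q.+1,
    pESF t nu (csize r) [mset r] = pESF t nu' (csize r) [mset r]) ->
  forall u, cmoment nu u = cmoment nu' u.
Proof.
move=> t0 E u; have [->|u0] := eqVneq u 0; first by rewrite !cmoment0.
pose r := Cvec u0; rewrite -[u]/(cvec_val r).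
have := E r.
have := pESF_msetn t nu r (ltn0Sn 0); have := pESF_msetn t nu' r (ltn0Sn 0).
rewrite mul1n => -> ->; rewrite !invr1 !mul1r !expr1.
have c0 : (csize r)`!%:R / rising t (csize r) != 0.
  by rewrite gt_eqF// divr_gt0 ?rising_gt0// ltr0n fact_gt0.
move=> /(mulfI c0); apply: mulfI.
by rewrite gt_eqF// mulr_gt0 ?cmultinom_gt0// divr_gt0// ltr0n cvec_csize_gt0.
Qed.

(** With [p] the moment of order one of the first colour, the mass is [p] at one unit
    block of this colour and [t / (t + 1) * p ^+ 2] at two, and [t / (t + 1)]
    determines [t]. *)
Lemma parameter_unique t t' nu nu' : 0 < t -> 0 < t' ->
  let e := grow (0 : {ffun 'I_q.+1 -> nat}) ord0 in
  pESF t nu 1 [mset e] = pESF t' nu' 1 [mset e] -> 0 < pESF t nu 1 [mset e] ->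
  pESF t nu 2 (msetn 2 e) = pESF t' nu' 2 (msetn 2 e) -> t' = t.
Proof.
move=> t0 t'0 e.
have e1 : csize e = 1%N by exact: csize_grow0.
have E1 x mu : 0 < x -> pESF x mu 1 [mset e] = cmultinom R e * cmoment mu e.
  move=> x0; have := pESF_msetn x mu e (ltn0Sn 0); rewrite e1 => ->.
  rewrite /rising big_ord1 addr0 invr1 !mul1r expr1.
  by field; rewrite gt_eqF.
have E2 x mu : 0 < x ->
    pESF x mu 2 (msetn 2 e) = x / (x + 1) * (cmultinom R e * cmoment mu e) ^+ 2.
  move=> x0; have := pESF_msetn x mu e (ltn0Sn 1); rewrite e1 => ->.
  rewrite /rising big_ord_recr big_ord1 /= addr0.
  by field; rewrite !gt_eqF// ltr_wpDr.
rewrite !E1// !E2// => <- p0 /(mulIf (lt0r_neq0 (exprn_gt0 2 p0))) /eqP.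
have d x : 0 < x -> x + 1 != 0 by move=> x0; rewrite gt_eqF// addr_gt0.
by rewrite eqr_div ?d// !mulrDr !mulr1 (mulrC t) => /eqP/addrI.
Qed.

End identification.

Theorem theorem4 (R : realType) (q : nat) (P : nat -> {mset cvec q.+1}%mset -> R)
    (Pstruct : cpart_structure P)
    (Ppos : forall (n : nat) (A : {mset cvec q.+1}%mset),
       (1 <= n)%N -> cpart q.+1 n A -> 0 < P n A)
    (Pfactor : exists b : nat -> cvec q.+1 -> R,
       forall (n : nat) (A : {mset cvec q.+1}%mset) (r : cvec q.+1),
         (1 <= n)%N -> cpart q.+1 n A -> ([mset r] `<=` A)%mset ->
         (csize r)%:R * (A r)%:R * P n A
         = b n r * P (n - csize r)%N (A `\ r)%mset) :
  exists (theta : R) (nu : probability (borel_simplex R q) R),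
    [/\ 0 < theta,
        forall (n : nat) (A : {mset cvec q.+1}%mset),
          cpart q.+1 n A -> P n A = pESF theta nu n A
      & forall (theta' : R) (nu' : probability (borel_simplex R q) R),
          0 < theta' ->
          (forall (n : nat) (A : {mset cvec q.+1}%mset),
             cpart q.+1 n A -> P n A = pESF theta' nu' n A) ->
          theta' = theta /\
          forall B : set (borel_simplex R q), measurable B -> nu' B = nu B].
Proof.
have [b Pb] := Pfactor; have t0 := ewens_theta_gt0 Pstruct Ppos Pb.
have [nu nuE] := moment_measure_exists (limit_moment_gt0 Pstruct Ppos Pb)
  (sum_limit_moment Pstruct Ppos Pb) (limit_moment0 b).
have PE n A : cpart q.+1 n A -> P n A = pESF (ewens_theta b) nu n A.
  by move=> <-; exact: factorizing_pESF.
exists (ewens_theta b), nu; split=> // t' nu' t'0 PE'.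
pose e := grow (0 : {ffun 'I_q.+1 -> nat}) ord0.
have e1 : csize e = 1%N by exact: csize_grow0.
have c1 : cpart q.+1 1 [mset e]%mset by rewrite /cpart /= cweight1.
have c2 : cpart q.+1 2 (msetn 2 e) by rewrite /cpart /= cweight_msetn e1.
have tt' : t' = ewens_theta b.
  apply: (@parameter_unique _ _ _ _ nu nu') => //.
  - by rewrite -PE// -PE'.
  - by rewrite -PE//; exact: Ppos.
  - by rewrite -PE// -PE'.
split=> // B mB; apply: moment_determinacy => // u.
apply: (cmoment_inj t0) => r; have cr : cpart q.+1 (csize r) [mset r]%mset.
  by rewrite /cpart /= cweight1.
by rewrite -PE// PE'// tt'.
Qed.
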